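(* Let $H>0$ and $S_H=\{z\in\mathbb{C}:\,|\operatorname{Im} z|\le H\}$. Let $\mu$ be a positive (locally finite Borel) measure with support in $S_H$ such that for some positive constants $C_0,\rho$ $$\mu(\{z\in S_H:\,|\operatorname{Re} z|\le r\})\le C_0\max\{1,r^\rho\}\quad\text{for all } r>0.$$ Suppose that the c-Fourier transform $\hat\mu^c$ of $\mu$ is a measure on $\mathbb{R}$. Then $\mu$ is translation bounded on $S_H$, i.e. $$\sup_{s\in\mathbb{R}}\mu(\{z\in S_H:\,s\le\operatorname{Re} z\le s+1\})<\infty.$$
   Context: For a function $\varphi\in L^1(\mathbb{R})$ with compact support, set $\hat\varphi^c(z)=\int_{\mathbb{R}}\varphi(t)e^{-2\pi i z t}\,dt$ for $z\in\mathbb{C}$ (an entire function). Let $\mathcal{D}$ be the space of $C^\infty$ functions on $\mathbb{R}$ with compact support. For a measure $\mu$ on $S_H$ satisfying the growth condition above, its c-Fourier transform $\hat\mu^c$ is the continuous linear functional on $\mathcal{D}$ defined by $(\hat\mu^c,\varphi)=\int_{S_H}\hat\varphi^c(z)\,\mu(dz)$. ''$\hat\mu^c$ is a measure'' means there is a (complex, locally finite) Borel measure $\sigma$ on $\mathbb{R}$ with $(\hat\mu^c,\varphi)=\int_{\mathbb{R}}\varphi\,d\sigma$ for all $\varphi\in\mathcal{D}$. *)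

(* Defs.v *)
(* Complex plane modelled as R * R
   (z = (Re z, Im z)), complex values written as (real part, imaginary part). *)
From HB Require Import structures.
From mathcomp Require Import all_boot all_order all_algebra.
From mathcomp Require Import all_classical all_reals all_analysis.
Set Implicit Arguments. Unset Strict Implicit. Unset Printing Implicit Defensive.
Import Order.TTheory GRing.Theory Num.Theory.
Import numFieldNormedType.Exports.
Local Open Scope classical_set_scope.
Local Open Scope ring_scope.

Definition strip (R : realType) (H : R) : set (R * R) :=
  [set z | `|z.2| <= H].

(* real-valued C^oo functions with compact support; a complex test function
   phi in D is a pair (p1, p2) of such with phi = p1 + i p2 *)
Definition test_fun (R : realType) (f : R -> R) : Prop :=
  (forall (n : nat) (x : R), derivable (derive1n n f) x 1) /\
  (exists M : R, forall t : R, M < `|t| -> f t = 0).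

(* real and imaginary parts of  \hat phi^c(z) = \int phi(t) e^{-2 pi i z t} dt
   for phi = p1 + i p2 and z = x + i y :
   e^{-2 pi i z t} = e^{2 pi y t} (cos (2 pi x t) - i sin (2 pi x t)) *)
Definition cfourier_re (R : realType) (p1 p2 : R -> R) (z : R * R) : R :=
  Rintegral lebesgue_measure [set: R]
    (fun t => expR (2 * pi * z.2 * t) *
              (p1 t * cos (2 * pi * z.1 * t) + p2 t * sin (2 * pi * z.1 * t))).

Definition cfourier_im (R : realType) (p1 p2 : R -> R) (z : R * R) : R :=
  Rintegral lebesgue_measure [set: R]
    (fun t => expR (2 * pi * z.2 * t) *
              (p2 t * cos (2 * pi * z.1 * t) - p1 t * sin (2 * pi * z.1 * t))).

(* "\hat mu^c is a measure": there is a complex locally finite Borel measure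
   sigma on R, written sigma = (s1 - s2) + i (s3 - s4) with s1..s4 positive
   Borel measures finite on compact intervals, such that for every test
   function phi = p1 + i p2,
     \int_{S_H} \hat phi^c d mu = \int phi d sigma. *)
Definition cfourier_is_measure (R : realType)
    (mu : {measure set (R * R) -> \bar R}) (H : R) : Prop :=
  exists s1 s2 s3 s4 : {measure set R -> \bar R},
    (forall a b : R, (s1 `[a, b]%classic < +oo)%E /\ (s2 `[a, b]%classic < +oo)%E /\
                     (s3 `[a, b]%classic < +oo)%E /\ (s4 `[a, b]%classic < +oo)%E) /\
    (forall p1 p2 : R -> R, test_fun p1 -> test_fun p2 ->
       Rintegral mu (strip H) (cfourier_re p1 p2) =
         (Rintegral s1 [set: R] p1 - Rintegral s2 [set: R] p1)
       - (Rintegral s3 [set: R] p2 - Rintegral s4 [set: R] p2) /\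
       Rintegral mu (strip H) (cfourier_im p1 p2) =
         (Rintegral s1 [set: R] p2 - Rintegral s2 [set: R] p2)
       + (Rintegral s3 [set: R] p1 - Rintegral s4 [set: R] p1)).

(* Main.v *)
(* The transform of a smooth even compactly supported [phi] at [x + i y] has
   real part [u x y], the integral of [phi t * exp (2 pi y t) * cos (2 pi x t)].
   Take [phi t = psi t / cosh (2 pi H t)] with [psi] the autocorrelation of a
   bump.  Since tanh is odd, [u x (+-H)] is the cosine transform of [psi], which
   is a square modulus, hence nonnegative.  As [u] is harmonic and bounded, the
   minimum principle gives [u >= 0] on the whole strip, and [u >= c > 0] for
   [|x| <= 1] when the support of [phi] is small.  Modulating [phi] by
   [exp (2 pi i s t)] translates [u] by [s] without changing [|phi|], so
   [c * mu (box at s) <= \int u (x - s) y dmu], and this integral is bounded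
   uniformly in [s] because it is the integral of the modulated [phi] against
   the measure representing the transform of [mu].  The growth condition is
   used for the integrability of [u], which decays rapidly in [x]. *)
Require Import Defs.
From HB Require Import structures.
From mathcomp Require Import all_boot all_order all_algebra.
From mathcomp Require Import all_classical all_reals all_analysis.
From mathcomp Require Import measurable_realfun.
From mathcomp Require Import ring lra.
Set Implicit Arguments. Unset Strict Implicit. Unset Printing Implicit Defensive.
Import Order.TTheory GRing.Theory Num.Theory.
Import numFieldNormedType.Exports.
Local Open Scope classical_set_scope.
Local Open Scope ring_scope.

(** * Calculus of repeatedly differentiable functions, and a smooth bump *)

Section times_differentiable.
Context {R : realType}.
Implicit Types (f g : R -> R) (n : nat) (a b : R).

(** Carrying the chain of derivatives as witnesses, instead of iterating the derivative operator,
    lets every closure property follow by induction on [n] from the one-step differentiation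
    rule. *)
Fixpoint diffn n f : Prop :=
  if n is m.+1 then
    exists2 f' : R -> R, (forall x : R, is_derive x (1 : R) f (f' x)) & diffn m f'
  else True.

Lemma diffnW n f : diffn n.+1 f -> diffn n f.
Proof.
elim: n f => // n IH f [f' df Df]; exists f' => //; exact: IH.
Qed.

(** Bridge from [diffn] to the form of smoothness required by [test_fun]. *)
Lemma diffn_derivable n f : diffn n.+1 f -> forall x, derivable (derive1n n f) x 1.
Proof.
elim: n f => [|n IH] f [f' df Df] x; first exact: ex_derive.
rewrite derive1Sn (_ : (f^`())%classic = f'); first exact: IH.
by apply/funext => t; rewrite derive1E derive_val.
Qed.

Lemma is_derive_continuous f f' : (forall x : R, is_derive x (1 : R) f (f' x)) ->
  continuous f.
Proof.
move=> df x; apply: differentiable_continuous.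
by apply/derivable1_diffP; exact: ex_derive.
Qed.

Lemma diffn_continuous n f : diffn n.+1 f -> continuous f.
Proof. by move=> [f' df _]; exact: is_derive_continuous df. Qed.

Lemma diffn_cst n a : diffn n (fun=> a).
Proof.
elim: n a => // n IH a; exists (fun=> 0) => //.
by move=> x; exact: is_derive_cst.
Qed.

Lemma diffnD n f g : diffn n f -> diffn n g -> diffn n (fun x => f x + g x).
Proof.
elim: n f g => // n IH f g [f' df Df] [g' dg Dg].
exists (fun x => f' x + g' x); last exact: IH.
by move=> x; exact: is_deriveD.
Qed.

Lemma diffnM n f g : diffn n f -> diffn n g -> diffn n (fun x => f x * g x).
Proof.
elim: n f g => // n IH f g /[dup] /diffnW Df0 [f' df Df] /[dup] /diffnW Dg0.
move=> [g' dg Dg].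
exists (fun x => f x * g' x + g x * f' x).
  by move=> x; exact: is_deriveM.
by apply: diffnD; exact: IH.
Qed.

(** The derivative of [1/f] is [-(1/f)^2 f'], which involves only [f'] and [1/f] itself, so the
    induction hypothesis and the product rule suffice. *)
Lemma diffn_inv n f : (forall x, f x != 0) -> diffn n f ->
  diffn n (fun x => (f x)^-1).
Proof.
move=> f0; elim: n => // n IH /[dup] /diffnW /IH Dv [f' df Df].
exists (fun x => -1 * ((f x)^-1 * (f x)^-1) * f' x).
  move=> x; apply: (is_derive_eq (is_deriveV (f0 x) (df x))).
  by rewrite -exprVn expr2 mulN1r.
by apply: diffnM => //; apply: diffnM; [exact: diffn_cst|exact: diffnM].
Qed.

Lemma is_derive_affine f a b (d x : R) : is_derive (a * x + b) (1 : R) f d ->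
  is_derive x (1 : R) (fun t => f (a * t + b)) (a * d).
Proof.
move=> df; have dg : is_derive x (1 : R) (fun t => a * t + b) a.
  rewrite (_ : (fun t => _) = (fun t => a *: t) + (fun=> b))//.
  by apply: is_derive_eq; rewrite addr0 scaler1.
by rewrite mulrC; exact: is_derive1_comp.
Qed.

Lemma is_derive_scale f a (d x : R) : is_derive (a * x) (1 : R) f d ->
  is_derive x (1 : R) (fun t => f (a * t)) (a * d).
Proof.
rewrite -[a * x]addr0 => /is_derive_affine; congr is_derive.
by apply/funext => t; rewrite addr0.
Qed.

Lemma diffn_affine n f a b : diffn n f -> diffn n (fun t => f (a * t + b)).
Proof.
elim: n f => // n IH f [f' df Df]; exists (fun t => a * f' (a * t + b)).
  by move=> x; exact: is_derive_affine.
by apply: diffnM; [exact: diffn_cst|exact: IH].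
Qed.

Lemma diffn_expR n : diffn n (@expR R).
Proof. by elim: n => // n IH; exists expR => // x; exact: is_derive_expR. Qed.

(** The two claims are proved jointly because each function is, up to sign, the derivative of the
    other. *)
Lemma diffn_cos_sin n : diffn n (@cos R) /\ diffn n (@sin R).
Proof.
elim: n => // n [Dc Ds]; split; last by exists cos => // x; exact: is_derive_sin.
exists (fun x => -1 * sin x); first by move=> x; rewrite mulN1r; exact: is_derive_cos.
by apply: diffnM => //; exact: diffn_cst.
Qed.

Lemma diffn_scale n f a : diffn n f -> diffn n (fun t => f (a * t)).
Proof.
by move=> /(diffn_affine a 0); congr diffn; apply/funext => t; rewrite addr0.
Qed.

(* (P(1/x) e^{-1/x})' = Q(1/x) e^{-1/x} with Q = X^2 (P - P'), so this family is
   closed under differentiation. *)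
Definition flat_exp (P : {poly R}) (x : R) : R :=
  if 0 < x then P.[x^-1] * expR (- x^-1) else 0.

Lemma expn_le_expR n a : 0 <= a -> a ^+ n <= n`!%:R * expR a.
Proof.
case: n => [|n] a0.
  by rewrite fact0 expr0 mul1r (le_trans _ (expR_ge1Dx a))// lerDl.
rewrite mulrC -ler_pdivrMr ?ltr0n ?fact_gt0//.
by rewrite (le_trans _ (expR_ge1Dxn n a0))// lerDr.
Qed.

(** Each monomial satisfies [a^i <= i! e^a], by comparison with one term of the exponential series;
    the bounds are summed over the coefficients. *)
Lemma poly_le_expR (P : {poly R}) :
  exists2 C : R, 0 <= C & forall a, 0 <= a -> `|P.[a]| <= C * expR a.
Proof.
exists (\sum_(i < size P) `|P`_i| * i`!%:R).
  by apply: sumr_ge0 => i _; rewrite mulr_ge0.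
move=> a a0; rewrite horner_coef (le_trans (ler_norm_sum _ _ _))//.
rewrite mulr_suml ler_sum// => i _; rewrite normrM -mulrA ler_wpM2l//.
by rewrite ger0_norm ?exprn_ge0// expn_le_expR.
Qed.

(** The exponential bound for [X P] at [1/x] reads [|P(1/x)| / x <= C e^(1/x)]. This linear decay at
    [0+] is what gives differentiability at the origin. *)
Lemma flat_exp_le (P : {poly R}) :
  exists2 C : R, 0 <= C & forall x, 0 < x -> `|flat_exp P x| <= C * x.
Proof.
have [C C0 HC] := poly_le_expR ('X * P); exists C => // x x0.
rewrite /flat_exp x0 normrM [`|expR _|]ger0_norm ?expR_ge0//.
have := HC x^-1 (ltW (_ : 0 < x^-1)); rewrite invr_gt0 => /(_ x0).
rewrite hornerM hornerX normrM gtr0_norm ?invr_gt0// mulrC -ler_pdivlMr ?invr_gt0//.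
rewrite invrK => h; rewrite expRN ler_pdivrMr ?expR_gt0// (le_trans h)//.
by rewrite mulrAC.
Qed.

Lemma is_derive_flat_exp (P : {poly R}) (x : R) :
  is_derive x (1 : R) (flat_exp P) (flat_exp ('X^2 * (P - P^`())) x).
Proof.
have [x0|x0|->] := ltgtP x 0.
- rewrite [X in is_derive _ _ _ X](_ : _ = 0); last first.
    by rewrite /flat_exp ltNge (ltW x0).
  apply: (@near_eq_is_derive _ _ _ (cst 0)).
    near=> t; rewrite /flat_exp ltNge ltW//.
    near: t; exact: lt_nbhsl.
- rewrite {2}/flat_exp x0.
  apply: (@near_eq_is_derive _ R R (fun t : R => P.[t^-1] * expR (- t^-1))).
    near=> t; rewrite /flat_exp ifT//; near: t; exact: lt_nbhsr.
  have dV : is_derive x (1 : R) (fun t : R => t^-1) (- x ^- 2).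
    apply: is_derive_eq; first by apply: (@is_deriveV _ id); rewrite ?gt_eqF.
    by rewrite scaler1.
  have dP : is_derive x (1 : R) (fun t => P.[t^-1]) (P^`().[x^-1] * - x ^- 2).
    exact: is_derive1_comp.
  have dE : is_derive x (1 : R) (fun t => expR (- t^-1)) (expR (- x^-1) * - - x ^- 2).
    exact: (@is_derive1_comp _ expR (fun t => - t^-1)).
  apply: (is_derive_eq (is_deriveM dP dE)).
  by rewrite /GRing.scale/= !hornerE /= -!exprVn; ring.
- rewrite {2}/flat_exp ltxx.
  have [C C0 HC] := flat_exp_le ('X * P).
  suff: h^-1 *: (flat_exp P (h + 0) - flat_exp P 0) @[h --> 0^'] --> (0 : R).
    move=> h; apply: DeriveDef; last first.
      apply: cvg_lim => //; apply: cvg_trans h; apply: near_eq_cvg.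
      by near=> t; rewrite /= scaler1.
    apply/cvg_ex; exists 0; apply: cvg_trans h; apply: near_eq_cvg.
    by near=> t; rewrite /= scaler1.
  apply/cvgrPdist_le => /= e e0; near=> h.
  rewrite sub0r normrN addr0 {2}/flat_exp ltxx subr0 /GRing.scale/=.
  have [h0|h0] := ltP 0 h; last first.
    by rewrite /flat_exp ltNge h0 mulr0 normr0 ltW.
  (* For [h > 0] the difference quotient at 0 belongs to the same family, with [P] replaced by
     [X P], and is therefore O(h). *)
  rewrite (_ : _ * _ = flat_exp ('X * P) h); last first.
    by rewrite /flat_exp h0 hornerM hornerX mulrA.
  apply: (le_trans (HC _ h0)).
  rewrite (@le_trans _ _ ((C + 1) * `|h|))//.
    by rewrite gtr0_norm// ler_wpM2r ?lerDl// ltW.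
  rewrite mulrC -ler_pdivlMr ?ltr_wpDl//.
  near: h; apply: dnbhs0_le; rewrite divr_gt0// ltr_wpDl//.
Unshelve. all: end_near. Qed.

Lemma diffn_flat_exp n (P : {poly R}) : diffn n (flat_exp P).
Proof.
elim: n P => // n IH P; exists (flat_exp ('X^2 * (P - P^`()))) => //.
by move=> x; exact: is_derive_flat_exp.
Qed.

(** For [a > 0] this is the classical bump [exp (- 2a / (a^2 - x^2))] on []-a, a[], extended by
    zero. *)
Definition smooth_bump a (x : R) : R := flat_exp 1 (a + x) * flat_exp 1 (a - x).

Lemma flat_exp1 x : flat_exp 1 x = if 0 < x then expR (- x^-1) else 0.
Proof. by rewrite /flat_exp hornerE mul1r. Qed.

Lemma flat_exp1_ge0 x : 0 <= flat_exp 1 x.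
Proof. by rewrite flat_exp1; case: ifP => // _; rewrite expR_ge0. Qed.

Lemma bump_ge0 a x : 0 <= smooth_bump a x.
Proof. by rewrite mulr_ge0 ?flat_exp1_ge0. Qed.

Lemma bump_supp a x : a < `|x| -> smooth_bump a x = 0.
Proof.
rewrite /smooth_bump !flat_exp1 lter_normr => /orP[ax|ax].
  by rewrite [X in _ * X]ifF ?mulr0//; apply/negbTE; rewrite -leNgt; lra.
by rewrite ifF ?mul0r//; apply/negbTE; rewrite -leNgt; lra.
Qed.

(** Both [a + x] and [a - x] are at least [a/2], so each factor is at least [exp (- 2/a)]. *)
Lemma bump_ge a x : 0 < a -> `|x| <= a / 2 -> expR (- (4 / a)) <= smooth_bump a x.
Proof.
move=> a0; rewrite ler_norml => /andP[xl xr].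
have h t : a / 2 <= t -> expR (- (2 / a)) <= flat_exp 1 t.
  move=> at2; have t0 : 0 < t by rewrite (lt_le_trans _ at2)// divr_gt0.
  rewrite flat_exp1 t0 ler_expR lerN2 -[2 / a]invrK invf_div lef_pV2// posrE//.
  by rewrite divr_gt0.
rewrite (_ : - (4 / a) = - (2 / a) - 2 / a); last by lra.
by rewrite expRD ler_pM ?expR_ge0//; apply: h; lra.
Qed.

Lemma diffn_bump n a : diffn n (smooth_bump a).
Proof.
have D := diffn_flat_exp n 1.
apply: diffnM; first (move: (diffn_affine 1 a D)); last (move: (diffn_affine (-1) a D));
 by congr diffn; apply/funext => t; congr flat_exp; ring.
Qed.

End times_differentiable.

(** * Integrals of continuous compactly supported functions *)

Section compactly_supported_integrals.
Context {R : realType}.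
Implicit Types (f g : R -> R) (M N a : R) (m : {measure set R -> \bar R}).
Local Notation mu := (@lebesgue_measure R).

Local Notation seg M := (`[(- M)%R, M%R]%classic).

Definition supp_le M f := forall t, M < `|t| -> f t = 0.

Lemma supp_leMr M f g : supp_le M f -> supp_le M (fun t => f t * g t).
Proof. by move=> f0 t Mt; rewrite f0// mul0r. Qed.

Lemma supp_le_derive M f (d x : R) : supp_le M f -> M < `|x| ->
  is_derive x (1 : R) f d -> d = 0.
Proof.
move=> f0 Mx df; have : is_derive x (1 : R) f 0.
  apply: (@near_eq_is_derive _ R R (cst 0)).
  near=> t; rewrite f0//; near: t.
  have : `|t| @[t --> x] --> `|x| by exact: cvg_norm.
  by move=> /cvgr_gt; apply.
by move=> df0; rewrite -(@derive_val _ _ _ _ _ _ _ df) (@derive_val _ _ _ _ _ _ _ df0).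
Unshelve. all: end_near. Qed.

Lemma Rintegral_setTE d (T : measurableType d) (m : {measure set T -> \bar R})
    (D : set T) (f : T -> R) :
  (forall t, ~ D t -> f t = 0) -> Rintegral m [set: T] f = Rintegral m D f.
Proof.
move=> f0; rewrite [RHS]Rintegral_mkcond; apply: eq_Rintegral => t _.
by rewrite patchE; case: ifPn => // /negP Dt; apply: f0 => ?; apply: Dt; rewrite inE.
Qed.

Lemma lebesgue_setTE (D : set R) f : (forall t, ~ D t -> f t = 0) ->
  Rintegral mu [set: R] f = Rintegral mu D f.
Proof. exact: (@Rintegral_setTE _ _ mu). Qed.

Lemma notin_itvN M (t : R) : ~ (seg M) t -> M < `|t|.
Proof. by rewrite /= in_itv/= -ler_norml ltNge => /negP. Qed.

Lemma supp_le_bounded M f : continuous f -> supp_le M f ->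
  exists2 B : R, 0 <= B & forall t, `|f t| <= B.
Proof.
(* [M] may be negative, so the maximum is taken over the interval of half-length [|M|], which is
   never empty. *)
move=> cf f0; have ab : - `|M| <= `|M| by rewrite lerNl (le_trans _ (normr_ge0 _)) ?oppr_le0.
have [|c _ Hc] := @EVT_max R (fun t => `|f t|) _ _ ab.
  by apply: continuous_subspaceT => t; apply: cvg_norm; exact: cf.
exists `|f c| => // t; have [tM|tM] := leP `|t| `|M|.
  by apply: Hc; rewrite in_itv/= -ler_norml.
by rewrite f0 ?normr0// (le_lt_trans (ler_norm _)).
Qed.

Lemma supp_le_integrable m M f : (m (seg M) < +oo)%E ->
  continuous f -> supp_le M f -> m.-integrable [set: R] (EFin \o f).
Proof.
move=> mM cf f0; have [B B0 fB] := supp_le_bounded cf f0.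
rewrite (_ : EFin \o f = (EFin \o f) \_ (seg M)); last first.
  apply/funext => t; rewrite patchE; case: ifPn => // /negP Dt /=.
  by rewrite f0//; apply: notin_itvN => ?; apply: Dt; rewrite inE.
apply/(integrable_mkcond _ (measurable_itv _)).
apply: measurable_bounded_integrable => //.
  by apply: measurable_funS (continuous_measurable_fun cf).
exists B; split; first exact: num_real.
by move=> x Bx t _ /=; rewrite (le_trans (fB t))// ltW.
Qed.

Lemma supp_le_lebesgue_integrable M f :
  continuous f -> supp_le M f -> mu.-integrable [set: R] (EFin \o f).
Proof.
move=> cf f0.
rewrite (_ : EFin \o f = (EFin \o f) \_ (seg M)); last first.
  apply/funext => t; rewrite patchE; case: ifPn => // /negP Dt /=.
  by rewrite f0//; apply: notin_itvN => ?; apply: Dt; rewrite inE.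
apply/(@integrable_mkcond _ _ _ mu (seg M)) => //.
apply: continuous_compact_integrable; first exact: segment_compact.
exact: continuous_subspaceT.
Qed.

Lemma le_norm_Rintegral_supp_le m M f B : (m (seg M) < +oo)%E ->
  continuous f -> supp_le M f -> (forall t, `|f t| <= B) ->
  `|Rintegral m [set: R] f| <= B * fine (m (seg M)).
Proof.
move=> mM cf f0 fB.
rewrite (@Rintegral_setTE _ _ _ (seg M)); last by move=> t /notin_itvN/f0.
have fi : m.-integrable (seg M) (EFin \o f).
  by apply: integrableS (supp_le_integrable mM cf f0).
rewrite (le_trans (le_normr_Rintegral _ fi))// -Rintegral_cst//.
apply: le_Rintegral => //; first exact: integrable_norm.
apply: measurable_bounded_integrable => //.
exists `|B|; split; first exact: num_real.
by move=> x Bx t _ /=; rewrite ltW.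
Qed.

(** Fundamental theorem of calculus; this is the form in which integration by parts is used
    later. *)
Lemma Rintegral_derive0 M f f' : (forall x, is_derive x (1 : R) f (f' x)) ->
  continuous f' -> supp_le M f -> Rintegral mu [set: R] f' = 0.
Proof.
(* [supp_le] gives vanishing only strictly beyond [M], so the endpoints are pushed out by 1. *)
move=> df cf' f0; pose N : R := `|M| + 1.
have MN : M < N by rewrite (le_lt_trans (ler_norm _))// ltrDl.
have N0 : - N < N by rewrite gtrN// ltr_wpDl.
have cf : continuous f by exact: is_derive_continuous df.
rewrite (@lebesgue_setTE (seg N)); last first.
  by move=> t /notin_itvN Nt; apply: supp_le_derive (lt_trans MN Nt) (df t).
rewrite /Rintegral (@continuous_FTC2 _ f' f)//.
- have N1 : M < `|N| by rewrite (lt_le_trans MN)// ler_norm.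
  by rewrite !f0 ?normrN//= subr0.
- exact: continuous_subspaceT.
- split; first by move=> x _; exact: ex_derive.
    by apply: cvg_at_right_filter; exact: cf.
  by apply: cvg_at_left_filter; exact: cf.
- by move=> x _; rewrite derive1E derive_val.
Qed.

Lemma Rintegral_opp M f : continuous f -> supp_le M f ->
  Rintegral mu [set: R] (fun t => f (- t)) = Rintegral mu [set: R] f.
Proof.
move=> cf f0; rewrite [RHS](@lebesgue_setTE (seg `|M|)); last first.
  by move=> t /notin_itvN tM; apply: f0; rewrite (le_lt_trans _ tM)// ler_norm.
rewrite (@lebesgue_setTE (seg `|M|)); last first.
  by move=> t /notin_itvN tM; apply: f0; rewrite normrN (le_lt_trans _ tM)// ler_norm.
have N0 : - `|M| <= `|M| by rewrite ge0_cp.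
have := @integration_by_substitution_oppr _ f _ _ N0.
rewrite opprK /Rintegral => ->//; exact: continuous_subspaceT.
Qed.

Lemma Rintegral_shift M f a : continuous f -> supp_le M f ->
  Rintegral mu [set: R] (fun t => f (t + a)) = Rintegral mu [set: R] f.
Proof.
(* With this [N], the interval [[-N, N]] supports the shifted function and its translate by [a]
   supports [f]. *)
move=> cf f0; pose N : R := `|M| + `|a|.
have N0 : - N <= N by rewrite ge0_cp// addr_ge0.
pose F (t : R) := t + a.
have dF x : is_derive x (1 : R) F 1.
  exact: is_derive_shift.
have F'E : (F^`())%classic = cst 1.
  by apply/funext => x; rewrite derive1E derive_val.
have cF : continuous F by exact: is_derive_continuous dF.
rewrite [RHS](@lebesgue_setTE `[F (- N), F N]%classic); last first.
  move=> t; rewrite /= in_itv/= /F /N => tN; apply: f0; apply: contra_notT tN.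
  have := ler_norm M; have := ler_norm a; have := ler_norm (- a); rewrite normrN.
  rewrite -leNgt ler_norml => ? ? ? /andP[? ?]; apply/andP; split; lra.
rewrite (@lebesgue_setTE (seg N)); last first.
  move=> t /notin_itvN; rewrite /N => tN; apply: f0.
  have := ler_normB (t + a) a; rewrite addrK; have := ler_norm M; lra.
rewrite /Rintegral (@integration_by_substitution_increasing _ F f)//.
- by congr fine; apply: eq_integral => t _; rewrite F'E /= !fctE mulr1.
- by move=> x y _ _ xy; rewrite /F ltrD2r.
- by rewrite F'E => x _; exact: cvg_cst.
- by rewrite F'E; exact: is_cvg_cst.
- by rewrite F'E; exact: is_cvg_cst.
- split; first by move=> x _; exact: ex_derive.
    apply: cvg_at_right_filter; exact: cF.
  apply: cvg_at_left_filter; exact: cF.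
- exact: continuous_subspaceT.
Qed.

Definition ccont f := continuous f /\ exists M, supp_le M f.

Lemma ccont_integrable f : ccont f -> mu.-integrable [set: R] (EFin \o f).
Proof. by move=> [cf [M f0]]; exact: supp_le_lebesgue_integrable f0. Qed.

Lemma ccontMr f g : ccont f -> continuous g -> ccont (fun t => f t * g t).
Proof.
move=> [cf [M f0]] cg; split; last by exists M; exact: supp_leMr.
by move=> x; apply: cvgM; [exact: cf|exact: cg].
Qed.

Lemma ccontMl f g : ccont f -> continuous g -> ccont (fun t => g t * f t).
Proof.
by move=> cf /(ccontMr cf); congr ccont; apply/funext => t; rewrite mulrC.
Qed.

Lemma ccontZ f a : ccont f -> ccont (fun t => a * f t).
Proof. by move=> cf; apply: ccontMl => // x; exact: cvg_cst. Qed.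

Lemma ccontD f g : ccont f -> ccont g -> ccont (fun t => f t + g t).
Proof.
move=> [cf [M f0]] [cg [N g0]]; split.
  by move=> x; apply: cvgD; [exact: cf|exact: cg].
exists (Num.max M N) => t; rewrite gt_max => /andP[tM tN].
by rewrite f0// g0// addr0.
Qed.

Lemma Rintegral_ccontD f g : ccont f -> ccont g ->
  Rintegral mu [set: R] (fun t => f t + g t) =
  Rintegral mu [set: R] f + Rintegral mu [set: R] g.
Proof. by move=> cf cg; rewrite RintegralD//; exact: ccont_integrable. Qed.

Lemma Rintegral_ccontZ f a : ccont f ->
  Rintegral mu [set: R] (fun t => a * f t) = a * Rintegral mu [set: R] f.
Proof. by move=> cf; rewrite RintegralZl//; exact: ccont_integrable. Qed.

Lemma le_Rintegral_ccont f g : ccont f -> ccont g -> (forall t, f t <= g t) ->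
  Rintegral mu [set: R] f <= Rintegral mu [set: R] g.
Proof.
by move=> cf cg fg; apply: le_Rintegral => //; exact: ccont_integrable.
Qed.

Lemma le_norm_Rintegral_ccont f g : ccont f -> ccont g ->
  (forall t, `|f t| <= g t) ->
  `|Rintegral mu [set: R] f| <= Rintegral mu [set: R] g.
Proof.
move=> cf cg fg; have iF := ccont_integrable cf.
rewrite (le_trans (le_normr_Rintegral _ iF))//.
apply: le_Rintegral => //; [exact: integrable_norm|exact: ccont_integrable].
Qed.

End compactly_supported_integrals.

(** * Correlations, Fubini, and the cosine transform of an autocorrelation *)

Section correlation.
Context {R : realType}.
Implicit Types (f g : R -> R) (a b B N : R) (n : nat).
Local Notation mu := (@lebesgue_measure R).
Local Notation seg M := (`[(- M)%R, M%R]%classic).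

Definition corr f g (t : R) : R := Rintegral mu [set: R] (fun s => f s * g (s + t)).

Lemma continuous_comp_shift g a : continuous g -> continuous (fun t => g (t + a)).
Proof.
move=> cg x; apply: (@continuous_comp _ _ _ (fun t => t + a) g); last exact: cg.
by apply: cvgD; [exact: cvg_id|exact: cvg_cst].
Qed.

Lemma continuousMf f g : continuous f -> continuous g ->
  continuous (fun t => f t * g t).
Proof. by move=> cf cg x; apply: cvgM; [exact: cf|exact: cg]. Qed.

Lemma continuousDf f g : continuous f -> continuous g ->
  continuous (fun t => f t + g t).
Proof. by move=> cf cg x; apply: cvgD; [exact: cf|exact: cg]. Qed.

Lemma continuous_norm f : continuous f -> continuous (fun t => `|f t|).
Proof. by move=> cf x; apply: cvg_norm; exact: cf. Qed.

(** Differentiation under the integral sign: the parameter [t] occurs only in [g]. *)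
Lemma is_derive_corr a b f g g' (t : R) : continuous f -> supp_le a f ->
  (forall x : R, is_derive x (1 : R) g (g' x)) -> continuous g' -> supp_le b g ->
  is_derive t (1 : R) (corr f g) (corr f g' t).
Proof.
move=> cf f0 dg cg' g0.
have g'0 : supp_le b g' by move=> x bx; exact: supp_le_derive bx (dg x).
have [B B0 g'B] := supp_le_bounded cg' g'0.
have cg : continuous g by exact: is_derive_continuous dg.
pose F t s := f s * g (s + t).
have dF x s : is_derive x (1 : R) (F ^~ s) (f s * g' (s + x)).
  have dg1 : is_derive x (1 : R) (fun x => g (s + x)) (g' (s + x)).
    have := @is_derive_affine R g 1 s (g' (s + x)) x.
    rewrite !mul1r addrC => /(_ (dg _)); congr is_derive.
    by apply/funext => z; rewrite mul1r addrC.
  by apply: (is_derive_eq (is_deriveZ (f s) dg1)).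
have tI : `]t - 1, t + 1[%classic t by rewrite /= in_itv/=; lra.
(* Dominating function, uniform in the parameter: [B] bounds [g'], and [f] provides the compact
   support. *)
pose G s : R := `|f s| * B.
have G0 s : 0 <= G s by rewrite mulr_ge0.
have iF x : `]t - 1, t + 1[%classic x -> mu.-integrable [set: R] (EFin \o F x).
  move=> _; apply: (@supp_le_lebesgue_integrable _ a).
    by apply: continuousMf => //; exact: continuous_comp_shift.
  exact: supp_leMr.
have iG : mu.-integrable [set: R] (EFin \o G).
  apply: (@supp_le_lebesgue_integrable _ a).
    by apply: continuousMf; [exact: continuous_norm|move=> ?; exact: cvg_cst].
  by move=> s sa; rewrite /G f0// normr0 mul0r.
have ubF x s : `]t - 1, t + 1[%classic x -> [set: R] s -> `|partial1of2 F x s| <= G s.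
  move=> _ _; rewrite partial1of2E derive_val normrM ler_wpM2l//.
have derF x s : `]t - 1, t + 1[%classic x -> [set: R] s -> derivable (F ^~ s) x 1.
  by move=> _ _; exact: ex_derive.
have D1 := @derivable_under_integral R _ _ mu F [set: R] measurableT t _ _ tI
  iF derF G G0 iG ubF.
have D2 := @differentiation_under_integral R _ _ mu F [set: R] measurableT t _ _ tI
  iF derF G G0 iG ubF.
apply: DeriveDef; first exact: D1.
rewrite -derive1E D2; apply: eq_Rintegral => s _.
by rewrite partial1of2E derive_val.
Qed.

(** All derivatives fall on [g]; the extra order in the hypothesis makes each derivative used under
    the integral continuous. *)
Lemma diffn_corr n a b f g : continuous f -> supp_le a f ->
  diffn n.+1 g -> supp_le b g -> diffn n (corr f g).
Proof.
move=> cf f0; elim: n g => // n IH g [g' dg Dg] g0.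
exists (corr f g'); last first.
  by apply: IH => // x bx; exact: supp_le_derive bx (dg x).
by move=> x; apply: is_derive_corr cf f0 dg _ g0; exact: diffn_continuous Dg.
Qed.

Lemma corr_supp a b f g : supp_le a f -> supp_le b g -> supp_le (a + b) (corr f g).
Proof.
move=> f0 g0 t abt; rewrite /corr (@eq_Rintegral _ _ _ _ _ (fun=> 0)).
  by rewrite Rintegral_cst// mul0r.
move=> s _; have [sa|sa] := ltP a `|s|; first by rewrite f0// mul0r.
rewrite (g0 (s + t)) ?mulr0//.
have := ler_normB (s + t) s; rewrite addrAC subrr add0r; lra.
Qed.

Lemma corr_ge0 f g : (forall t, 0 <= f t) -> (forall t, 0 <= g t) ->
  forall t, 0 <= corr f g t.
Proof. by move=> f0 g0 t; apply: Rintegral_ge0 => s _; rewrite mulr_ge0. Qed.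

(** Substituting [s + t] for [s] exchanges the two factors. *)
Lemma corr_even a f (t : R) : continuous f -> supp_le a f ->
  corr f f (- t) = corr f f t.
Proof.
move=> cf f0; rewrite /corr.
rewrite -(@Rintegral_shift _ a (fun s => f s * f (s - t)) t).
- by apply: eq_Rintegral => s _; rewrite addrK mulrC.
- by apply: continuousMf => //; exact: continuous_comp_shift.
- exact: supp_leMr.
Qed.

Lemma lebesgue_seg_lty N : (mu (seg N) < +oo)%E.
Proof.
apply: le_lt_trans (ltry (`|N - - N|)); rewrite [leLHS]lebesgue_measure_itv/=.
by case: ifP => _; rewrite -?EFinD lee_fin ?ler_norm.
Qed.

(** A bounded measurable function vanishing off a square is integrable for the product measure, so
    Fubini applies. *)
Lemma Rintegral_swap N B (F : R -> R -> R) :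
  measurable_fun [set: R * R] (fun z : R * R => F z.1 z.2) ->
  (forall t s, `|F t s| <= B) ->
  (forall t s, N < `|t| \/ N < `|s| -> F t s = 0) ->
  Rintegral mu [set: R] (fun t => Rintegral mu [set: R] (fun s => F t s)) =
  Rintegral mu [set: R] (fun s => Rintegral mu [set: R] (fun t => F t s)).
Proof.
move=> mF FB F0.
have segE (h : R -> R) : measurable_fun [set: R] h ->
  (forall t, `|h t| <= B) -> supp_le N h ->
    mu.-integrable [set: R] (EFin \o h).
  move=> mh hB h0.
  rewrite (_ : EFin \o h = (EFin \o h) \_ (seg N)); last first.
    apply/funext => t; rewrite patchE; case: ifPn => // /negP Dt /=.
    by rewrite h0//; apply: notin_itvN => ?; apply: Dt; rewrite inE.
  apply/(@integrable_mkcond _ _ _ mu (seg N)) => //.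
  apply: measurable_bounded_integrable => //.
  - exact: lebesgue_seg_lty.
  - exact: measurable_funS mh.
  - exists B; split; first exact: num_real.
    by move=> x Bx t _ /=; rewrite (le_trans (hB t))// ltW.
pose H (z : measurableTypeR R * measurableTypeR R) : \bar R := (F z.1 z.2)%:E.
have iH : (mu \x mu)%E.-integrable setT H.
  pose D : set (measurableTypeR R * measurableTypeR R) := seg N `*` seg N.
  have mD : measurable D by apply: measurableX.
  rewrite (_ : H = (EFin \o (fun z => F z.1 z.2)) \_ D); last first.
    apply/funext => -[t s]; rewrite patchE; case: ifPn => // /negP Dt /=.
    rewrite /H/= F0//; apply: contrapT => /not_orP[tN sN]; apply: Dt.
    rewrite inE; split; apply: contrapT => /notin_itvN//.
  apply/(@integrable_mkcond _ _ _ (mu \x mu)%E D) => //.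
  apply: measurable_bounded_integrable => //.
  - rewrite [ltLHS]product_measure1E//; apply: lte_mul_pinfty => //.
      by rewrite ge0_fin_numE//; exact: lebesgue_seg_lty.
    exact: lebesgue_seg_lty.
  - by apply: measurable_funS mF.
  - exists B; split; first exact: num_real.
    by move=> x Bx t _ /=; rewrite (le_trans (FB _ _))// ltW.
have fK (h : R -> R) : mu.-integrable [set: R] (EFin \o h) ->
   ((Rintegral mu [set: R] h)%:E = \int[mu]_x (h x)%:E)%E.
  by move=> ih; rewrite fineK//; exact: integrable_fin_num ih.
have i1 t : mu.-integrable [set: R] (EFin \o (fun s => F t s)).
  apply: segE => //; last by move=> s sN; apply: F0; right.
  exact: (measurable_fun_pair2 t mF).
have i2 s : mu.-integrable [set: R] (EFin \o (fun t => F t s)).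
  apply: segE => //; last by move=> t tN; apply: F0; left.
  exact: (measurable_fun_pair1 s mF).
rewrite /Rintegral; congr fine.
under eq_integral do rewrite (fK _ (i1 _)).
under [RHS]eq_integral do rewrite (fK _ (i2 _)).
exact: (Fubini iH).
Qed.

(** The autocorrelation has the square modulus of the transform of [f] as its Fourier transform; the
    right-hand side is that square modulus written in real terms. *)
Lemma Rintegral_corr_cos a f (w : R) : continuous f -> supp_le a f ->
  Rintegral mu [set: R] (fun t => corr f f t * cos (w * t)) =
  (Rintegral mu [set: R] (fun t => f t * cos (w * t))) ^+ 2 +
  (Rintegral mu [set: R] (fun t => f t * sin (w * t))) ^+ 2.
Proof.
move=> cf f0; have [B B0 fB] := supp_le_bounded cf f0.
have cw (h : R -> R) : continuous h -> continuous (fun t => h (w * t)).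
  move=> ch x; apply: (@continuous_comp _ _ _ (fun t => w * t) h); last exact: ch.
  by apply: cvgM; [exact: cvg_cst|exact: cvg_id].
have cc := cw _ (@continuous_cos R); have cs := cw _ (@continuous_sin R).
have ccf : ccont f by split=> //; exists a.
have ifc : ccont (fun t => f t * cos (w * t)) by exact: ccontMr.
have ifs : ccont (fun t => f t * sin (w * t)) by exact: ccontMr.
pose F t s := f s * f (s + t) * cos (w * t).
transitivity (Rintegral mu [set: R] (fun t => Rintegral mu [set: R] (fun s => F t s))).
  apply: eq_Rintegral => t _; rewrite /corr -RintegralZr//.
  apply: (@supp_le_lebesgue_integrable _ a); last exact: supp_leMr.
  by apply: continuousMf => //; exact: continuous_comp_shift.
(* If [f s * f (s + t)] is nonzero then [|s|] and [|s + t|] are at most [a], hence [|t| <= 2a]. *)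
rewrite (@Rintegral_swap (2 * `|a|) (B * B)); last 3 first.
- have mf := continuous_measurable_fun cf.
  apply: measurable_funM; last first.
    by apply: measurableT_comp (continuous_measurable_fun cc) _.
  apply: measurable_funM; first exact: measurableT_comp mf _.
  by apply: measurableT_comp mf _; apply: measurable_funD.
- move=> t s; rewrite !normrM -[leRHS]mulr1 !ler_pM ?mulr_ge0//; exact: cos_max.
- move=> t s ts; rewrite /F.
  have aa := ler_norm a; have a0 := normr_ge0 a.
  have [sa|sa] := ltP a `|s|; first by rewrite f0// !mul0r.
  rewrite (f0 (s + t)) ?mulr0 ?mul0r//.
  have := ler_normB (s + t) s; rewrite addrAC subrr add0r; case: ts; lra.
pose C := Rintegral mu [set: R] (fun t => f t * cos (w * t)).
pose S := Rintegral mu [set: R] (fun t => f t * sin (w * t)).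
transitivity (Rintegral mu [set: R] (fun s => C * (f s * cos (w * s)) + S * (f s * sin (w * s)))).
  apply: eq_Rintegral => s _.
  transitivity (Rintegral mu [set: R] (fun v => f s * cos (w * s) * (f v * cos (w * v)) +
      f s * sin (w * s) * (f v * sin (w * v)))); last first.
    rewrite [C * _]mulrC [S * _]mulrC.
    by rewrite Rintegral_ccontD ?Rintegral_ccontZ//; exact: ccontZ.
  (* Substitute [v = t + s]: by the addition formulas the trigonometric factor becomes [cos (w t)]
     times [cos^2 + sin^2] at [w s]. *)
  rewrite -[RHS](@Rintegral_shift _ a _ s).
  - apply: eq_Rintegral => t _; rewrite /F [t + s]addrC mulrDr cosD sinD.
    have := cos2Dsin2 (w * s); move: (cos (w * s)) (sin (w * s)) => c d cd.
    by rewrite -[cos _ in LHS]mul1r -cd; ring.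
  - by apply: continuousDf; apply: continuousMf; [move=> ?; exact: cvg_cst
      |exact: continuousMf|move=> ?; exact: cvg_cst|exact: continuousMf].
  - by move=> t ta; rewrite (f0 t)// !mul0r !mulr0 addr0.
by rewrite Rintegral_ccontD ?Rintegral_ccontZ//; exact: ccontZ.
Qed.

End correlation.

(** * A minimum principle on the strip from five-point differences *)

Section discrete_minimum_principle.
Context {R : realType}.

(* At an almost-minimum of v = u - d y^2 the five-point difference of v is
   almost nonnegative, while it equals that of u, which is o(h^2), minus 2 d h^2. *)
Lemma strip_minimum_principle (u : R -> R -> R) (H B L : R) : 0 < H ->
  (forall x y, `|y| <= H -> `|u x y| <= B) ->
  (forall x y y', `|y| <= H -> `|y'| <= H -> `|u x y - u x y'| <= L * `|y - y'|) ->
  (forall x, 0 <= u x H) -> (forall x, 0 <= u x (- H)) ->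
  (forall e : R, 0 < e -> exists2 h0 : R, 0 < h0 & forall h : R, 0 < h <= h0 ->
     forall x y, `|y| + h <= H ->
     `|u (x + h) y + u (x - h) y + u x (y + h) + u x (y - h) - 4 * u x y|
       <= e * h ^+ 2) ->
  forall x y, `|y| <= H -> 0 <= u x y.
Proof.
move=> H0 uB uL uH uNH umean x0 y0 y0H; rewrite leNgt; apply/negP => ux0.
pose m := - u x0 y0; have m0 : 0 < m by rewrite oppr_gt0.
(* With this [d] the correction [d y^2] stays below [m/2] on the strip, so it cannot by itself
   account for the value [-m]. *)
pose d := m / (2 * H ^+ 2).
have H2 : 0 < H ^+ 2 by rewrite exprn_gt0.
have d0 : 0 < d by rewrite divr_gt0// mulr_gt0.
have dH : d * H ^+ 2 = m / 2 by rewrite /d; field; rewrite gt_eqF.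
have dy (y : R) : `|y| <= H -> 0 <= d * y ^+ 2 <= m / 2.
  move=> yH; rewrite (mulr_ge0 (ltW d0) (sqr_ge0 _))/= -dH.
  rewrite (ler_pM2l d0) -[y ^+ 2]ger0_norm ?sqr_ge0// normrX.
  by rewrite lerXn2r// nnegrE ltW.
pose S := [set r | exists x y, `|y| <= H /\ r = u x y - d * y ^+ 2].
have Slb : lbound S (- B - m / 2).
  move=> _ [x [y [yH ->]]]; have := uB x _ yH; have /andP[_] := dy _ yH.
  rewrite ler_norml => ? /andP[? ?]; lra.
have hS : has_inf S.
  by split; [exists (u x0 y0 - d * y0 ^+ 2); exists x0, y0|exists (- B - m / 2)].
have Sinf x y : `|y| <= H -> inf S <= u x y - d * y ^+ 2.
  by move=> yH; apply: ge_inf; [case: hS|exists x, y].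
have [h0 h00 hm] := umean _ d0.
(* The three bounds make the five-point estimate available, keep the step within the strip width,
   and limit the variation of [u] over a vertical distance [h] to [m/4]. *)
pose h := Num.min (Num.min h0 H) (m / (4 * (`|L| + 1))).
have L1 : 0 < `|L| + 1 by rewrite ltr_wpDl.
have hpos : 0 < h.
  by rewrite !lt_min h00 H0 divr_gt0// mulr_gt0.
have hh0 : h <= h0 by rewrite !ge_min lexx.
have hH : h <= H by rewrite !ge_min lexx orbT.
have hL : (`|L| + 1) * h <= m / 4.
  have : h <= m / (4 * (`|L| + 1)) by rewrite !ge_min lexx orbT.
  rewrite ler_pdivlMr ?mulr_gt0// => ?; lra.
have h2 : 0 < d * h ^+ 2 by rewrite mulr_gt0// exprn_gt0.
have h2m : d * h ^+ 2 <= m / 2.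
  by rewrite -dH (ler_pM2l d0) lerXn2r// nnegrE ltW.
(* The strip is unbounded and the infimum may not be attained; a point within [d h^2 / 8] of it is
   enough. *)
have [_ [x1 [y1 [y1H ->]]] v1] := @inf_adherent _ S (d * h ^+ 2 / 8) (divr_gt0 h2 (ltr0Sn _ _)) hS.
have I0 := Sinf x0 y0 y0H.
have /andP[y00 _] := dy _ y0H; have /andP[y10 y1m] := dy _ y1H.
have [y1h|y1h] := leP (`|y1| + h) H; last first.
  (* Near the boundary [u >= -m/4], so [v = u - d y^2 >= -3m/4]; but at the chosen point
     [v < inf S + d h^2 / 8 <= -m + m/16]. *)
  have ge s : 0 <= u x1 s -> `|s| <= H -> `|y1 - s| <= h -> False.
    move=> us sH ys; have := uL x1 y1 s y1H sH => uy.
    have : L * `|y1 - s| <= (`|L| + 1) * h.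
      apply: (@le_trans _ _ (`|L| * h)); last by rewrite ler_wpM2r ?lerDl// ltW.
      apply: (@le_trans _ _ (`|L| * `|y1 - s|)); first by rewrite ler_wpM2r// ler_norm.
      by rewrite ler_wpM2l.
    move: uy; rewrite ler_norml => /andP[? ?] ?; rewrite /m in m0 hL h2m y1m *; lra.
  have [y1p|y1n] := leP 0 y1.
    apply: (ge H) => //; first by rewrite gtr0_norm.
    move: y1h y1H; rewrite (ger0_norm y1p) => ? ?; rewrite ler_norml; lra.
  apply: (ge (- H)) => //; first by rewrite normrN gtr0_norm.
  move: y1h y1H; rewrite (ltr0_norm y1n) => ? ?; rewrite ler_norml; lra.
have hin : 0 < h <= h0 by rewrite hpos.
have := hm _ hin x1 _ y1h; rewrite ler_norml => /andP[_ M1].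
have i1 := Sinf (x1 + h) y1 y1H; have i2 := Sinf (x1 - h) y1 y1H.
have i3 : inf S <= u x1 (y1 + h) - d * (y1 + h) ^+ 2.
  by apply: Sinf; rewrite (le_trans (ler_normD _ _))// (gtr0_norm hpos).
have i4 : inf S <= u x1 (y1 - h) - d * (y1 - h) ^+ 2.
  by apply: Sinf; rewrite (le_trans (ler_normB _ _))// (gtr0_norm hpos).
(* The five-point difference of [v] is at most [d h^2 - 2 d h^2 = - d h^2], yet near-minimality
   makes it exceed [- d h^2 / 2]. *)
have E : d * (y1 + h) ^+ 2 + d * (y1 - h) ^+ 2 = 2 * (d * y1 ^+ 2) + 2 * (d * h ^+ 2).
  by ring.
lra.
Qed.

Lemma sin_half (a : R) : cos a = 1 - 2 * sin (a / 2) ^+ 2.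
Proof.
have -> : a = a / 2 + a / 2 by lra.
rewrite cosD -!expr2 cos2sin2 (_ : (a / 2 + a / 2) / 2 = a / 2); last by lra.
by ring.
Qed.

(** With [b = a/2] the quantity equals [2 (sinh b - sin b) (sinh b + sin b)], where the first factor
    is o(b) and the second O(b). Thus first derivatives at 0 suffice, without a Taylor expansion. *)
Lemma cos_cosh_mean (e : R) : 0 < e -> exists2 d : R, 0 < d &
  forall a, `|a| <= d -> `|cos a + (expR a + expR (- a)) / 2 - 2| <= e * a ^+ 2.
Proof.
move=> e0; pose sh (b : R) := (expR b - expR (- b)) / 2.
have dsh : is_derive (0 : R) (1 : R) sh 1.
  have d2 : is_derive (0 : R) (1 : R) (fun b => expR (- b)) (- 1).
    have d0 : is_derive (-1 * 0 + 0 : R) (1 : R) expR 1.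
      by rewrite mulr0 addr0 -[X in is_derive _ _ _ X]expR0; exact: is_derive_expR.
    have := is_derive_affine d0; rewrite mulr1; congr is_derive.
    by apply/funext => z; rewrite mulN1r addr0.
  have d1 : is_derive (0 : R) (1 : R) expR 1.
    by rewrite -[X in is_derive _ _ _ X]expR0; exact: is_derive_expR.
  have := is_deriveZ (2^-1) (is_deriveB d1 d2).
  rewrite opprK /GRing.scale/= => /is_derive_eq; move=> /(_ 1); rewrite -mulr2n.
  rewrite mulVf// => /(_ erefl); congr is_derive.
  by apply/funext => z; rewrite /sh mulrC.
have lim (f : R -> R) (l e' : R) : is_derive (0 : R) (1 : R) f l -> f 0 = 0 -> 0 < e' ->
    exists2 d : R, 0 < d & forall b, `|b| <= d -> `|f b - l * b| <= e' * `|b|.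
  move=> [df ?] f0 e'0; have := df => /cvg_ex[l' cl'].
  have ll' : l' = l by rewrite -(cvg_lim _ cl').
  move: cl'; rewrite ll' => /cvgrPdist_le/(_ _ e'0) /nbhs_ballP[d /= d0 dP].
  exists (d / 2); first by rewrite divr_gt0.
  move=> b bd; have [->|b0] := eqVneq b 0.
    by rewrite f0 mulr0 subrr normr0 mulr0.
  have := dP b; rewrite /ball/= sub0r normrN => /(_ _ b0) /=.
  rewrite scaler1 addr0 f0 subr0 => /(_ _).
  have bd' : `|b| < d by rewrite (le_lt_trans bd)// ltr_pdivrMr// ltr_pMr// ltr1n.
  move=> /(_ bd'); rewrite distrC => h.
  rewrite (_ : f b - l * b = (b^-1 *: f b - l) * b).
    by rewrite normrM ler_wpM2r.
  by rewrite /GRing.scale/= mulrBl mulrAC mulVf// mul1r.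
have sh0 : sh 0 = 0 by rewrite /sh oppr0 subrr mul0r.
have dsin : is_derive (0 : R) (1 : R) sin 1.
  by rewrite -[X in is_derive _ _ _ X]cos0; exact: is_derive_sin.
(* The final bound is [2 * (2 e' |b|) * (4 |b|) = 4 e' a^2], whence [e/4]; the cap 1 yields the
   factor [4 |b|]. *)
pose e' := Num.min 1 (e / 4).
have e'0 : 0 < e' by rewrite lt_min ltr01 divr_gt0.
have [d1 d10 D1] := lim _ _ _ dsh sh0 e'0.
have [d2 d20 D2] := lim _ _ _ dsin (sin0 R) e'0.
exists (2 * Num.min d1 d2); first by rewrite mulr_gt0// lt_min d10.
move=> a ad; set b := a / 2.
have ba : a = 2 * b by rewrite /b; lra.
have bd : `|b| <= Num.min d1 d2.
  by move: ad; rewrite ba normrM gtr0_norm// ler_pM2l.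
have /andP[bd1 bd2] : (`|b| <= d1) && (`|b| <= d2) by rewrite -le_min.
have {}D1 := D1 b bd1; have {}D2 := D2 b bd2.
have ea : expR a = expR b ^+ 2 by rewrite expr2 -expRD ba; congr expR; ring.
have eNa : expR (- a) = expR (- b) ^+ 2 by rewrite expr2 -expRD ba; congr expR; ring.
have eb : expR b * expR (- b) = 1 by rewrite expRxMexpNx_1.
have -> : cos a + (expR a + expR (- a)) / 2 - 2 =
    2 * ((sh b - sin b) * (sh b + sin b)).
  rewrite sin_half -/b ea eNa /sh.
  have -> : (expR b ^+ 2 + expR (- b) ^+ 2) / 2 =
    (expR b - expR (- b)) ^+ 2 / 2 + expR b * expR (- b) by field.
  by rewrite eb; field.
rewrite normrM (gtr0_norm (ltr0Sn _ 1)) normrM.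
have b0 := normr_ge0 b.
have A1 : `|sh b - sin b| <= 2 * e' * `|b|.
  rewrite (_ : sh b - sin b = (sh b - 1 * b) - (sin b - 1 * b)); last by ring.
  rewrite (le_trans (ler_normB _ _))//; lra.
have A2 : `|sh b + sin b| <= 4 * `|b|.
  rewrite (_ : sh b + sin b = (sh b - 1 * b) + (sin b - 1 * b) + 2 * b); last by ring.
  rewrite (le_trans (ler_normD _ _))// (le_trans (lerD (ler_normD _ _) (lexx _)))//.
  have : e' * `|b| <= 1 * `|b| by rewrite ler_wpM2r// ge_min lexx.
  rewrite [`|2 * b|]normrM (gtr0_norm (ltr0Sn R 1)); lra.
apply: (@le_trans _ _ (2 * (2 * e' * `|b| * (4 * `|b|)))).
  by rewrite ler_pM2l// ler_pM.
rewrite ba exprMn -[b ^+ 2]real_normK ?num_real//.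
have : e' * `|b| ^+ 2 <= e / 4 * `|b| ^+ 2.
  by rewrite ler_wpM2r ?sqr_ge0// ge_min lexx orbT.
lra.
Qed.

End discrete_minimum_principle.

(** * Decay and measurability of the transform on the strip *)

Section cfourier_decay.
Context {R : realType}.
Implicit Types (p q f : R -> R) (a M H x y t : R) (n : nat).
Local Notation mu := (@lebesgue_measure R).

Lemma continuous_expR_scale a : continuous (fun t => expR (a * t)).
Proof. exact: (diffn_continuous (diffn_scale a (diffn_expR 1))). Qed.

Lemma continuous_cos_scale a : continuous (fun t => cos (a * t)).
Proof. by have [/(diffn_scale a)/diffn_continuous] := @diffn_cos_sin R 1. Qed.

Lemma continuous_sin_scale a : continuous (fun t => sin (a * t)).
Proof. by have [_ /(diffn_scale a)/diffn_continuous] := @diffn_cos_sin R 1. Qed.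

Definition cfourier_re_integrand p q x y t : R :=
  expR (2 * pi * y * t) *
  (p t * cos (2 * pi * x * t) + q t * sin (2 * pi * x * t)).

Lemma ccont_cfourier_re_integrand p q x y : ccont p -> ccont q ->
  ccont (cfourier_re_integrand p q x y).
Proof.
move=> cp cq; apply: ccontMl; last exact: continuous_expR_scale.
by apply: ccontD; apply: ccontMr => //;
  [exact: continuous_cos_scale|exact: continuous_sin_scale].
Qed.

Lemma expR_strip_le M H y t : `|y| <= H -> `|t| <= M ->
  expR (2 * pi * y * t) <= expR (2 * pi * H * M).
Proof.
move=> yH tM; rewrite ler_expR -!mulrA ler_pM2l// ler_pM2l ?pi_gt0//.
by rewrite (le_trans (ler_norm _))// normrM ler_pM.
Qed.

Lemma expR_supp_le M H y t p : `|y| <= H -> supp_le M p ->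
  `|expR (2 * pi * y * t) * p t| <= expR (2 * pi * H * M) * `|p t|.
Proof.
move=> yH p0; rewrite normrM [`|expR _|]ger0_norm ?expR_ge0//.
have [tM|tM] := leP `|t| M; first by rewrite ler_wpM2r// expR_strip_le.
by rewrite (p0 _ tM) normr0 !mulr0.
Qed.

Lemma cfourier_re_bounded M H p q : ccont p -> ccont q ->
  supp_le M p -> supp_le M q ->
  exists C : R, forall x y, `|y| <= H -> `|cfourier_re p q (x, y)| <= C.
Proof.
move=> cp cq p0 q0.
have cn f : ccont f -> ccont (fun t => `|f t|).
  move=> [cf [N f0]]; split; first by move=> t; apply: cvg_norm; exact: cf.
  by exists N => t tN; rewrite f0// normr0.
pose E := expR (2 * pi * H * M).
pose G t := E * (`|p t| + `|q t|).
exists (Rintegral mu [set: R] G) => x y yH.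
apply: (@le_norm_Rintegral_ccont _ (cfourier_re_integrand p q x y) G).
- exact: ccont_cfourier_re_integrand.
- by apply: ccontZ; apply: ccontD; exact: cn.
- move=> t; rewrite /cfourier_re_integrand (mulrDr (expR _)) /G (mulrDr E).
  rewrite (le_trans (ler_normD _ _))// lerD// mulrA normrM.
    rewrite -[leRHS]mulr1 ler_pM ?cos_max//; exact: expR_supp_le.
  rewrite -[leRHS]mulr1 ler_pM ?sin_max//; exact: expR_supp_le.
Qed.

(** For [phi = p + i q], this is the real part of the rule that [i phi'] has transform [-2 pi z]
    times that of [phi]. The pairs [(-q', p')] and [(-q, p)] encode [i phi'] and [i phi], so
    imaginary parts need no separate treatment. *)
Lemma cfourier_re_parts M p q p' q' x y :
  (forall t, is_derive t (1 : R) p (p' t)) -> (forall t, is_derive t (1 : R) q (q' t)) ->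
  continuous p' -> continuous q' -> supp_le M p -> supp_le M q ->
  2 * pi * x * cfourier_re p q (x, y) +
  (cfourier_re (fun t => - q' t) p' (x, y) +
   2 * pi * y * cfourier_re (fun t => - q t) p (x, y)) = 0.
Proof.
move=> dp dq cp' cq' p0 q0.
have cp := is_derive_continuous dp; have cq := is_derive_continuous dq.
have p'0 : supp_le M p' by move=> t Mt; exact: supp_le_derive Mt (dp t).
have q'0 : supp_le M q' by move=> t Mt; exact: supp_le_derive Mt (dq t).
have ccp : ccont p by split=> //; exists M.
have ccq : ccont q by split=> //; exists M.
have ccp' : ccont p' by split=> //; exists M.
have ccN f : ccont f -> ccont (fun t => - f t).
  by move=> /(ccontZ (-1)); congr ccont; apply/funext => t; rewrite mulN1r.
have ccNq : ccont (fun t => - q t) by exact: ccN.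
have ccNq' : ccont (fun t => - q' t) by apply: ccN; split=> //; exists M.
have c1 := ccont_cfourier_re_integrand x y ccp ccq.
have c2 := ccont_cfourier_re_integrand x y ccNq' ccp'.
have c3 := ccont_cfourier_re_integrand x y ccNq ccp.
rewrite /cfourier_re/=.
rewrite -(Rintegral_ccontZ _ c1) -(Rintegral_ccontZ _ c3) -(Rintegral_ccontD c2); last exact: ccontZ.
rewrite -Rintegral_ccontD; [|exact: ccontZ|by apply: ccontD => //; exact: ccontZ].
pose a := 2 * pi * y; pose b := 2 * pi * x.
apply: (@Rintegral_derive0 _ M (fun t => expR (a * t) * (p t * sin (b * t) - q t * cos (b * t)))).
- move=> t.
  have de := is_derive_scale (is_derive_expR (a * t)).
  have ds := is_derive_scale (is_derive_sin (b * t)).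
  have dc := is_derive_scale (is_derive_cos (b * t)).
  have := is_deriveM de (is_deriveB (is_deriveM (dp t) ds) (is_deriveM (dq t) dc)).
  move=> /is_derive_eq; apply.
  rewrite /GRing.scale/= /cfourier_re_integrand -/a -/b !fctE; ring.
- have [+ _] := ccontD (ccontZ b c1) (ccontD c2 (ccontZ a c3)); exact.
- by move=> t tM; rewrite p0// q0// !mul0r subrr mulr0.
Qed.

(** Each power of [x] is traded for one derivative by integration by parts; the term carrying [y] is
    controlled by [|y| <= H] and the same induction hypothesis. *)
Lemma cfourier_re_decay n M H p q : 0 <= H -> diffn n.+1 p -> diffn n.+1 q ->
  supp_le M p -> supp_le M q ->
  exists C : R, forall x y, `|y| <= H ->
    `|x| ^+ n * `|cfourier_re p q (x, y)| <= C.
Proof.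
move=> H0; elim: n p q => [|n IH] p q Dp Dq p0 q0.
  have cp : ccont p by split; [exact: diffn_continuous Dp|exists M].
  have cq : ccont q by split; [exact: diffn_continuous Dq|exists M].
  have [C HC] := cfourier_re_bounded H cp cq p0 q0.
  by exists C => x y yH; rewrite expr0 mul1r HC.
have Dp1 := diffnW Dp; have Dq1 := diffnW Dq.
have [p' dp Dp'] := Dp; have [q' dq Dq'] := Dq.
have p'0 : supp_le M p' by move=> t Mt; exact: supp_le_derive Mt (dp t).
have q'0 : supp_le M q' by move=> t Mt; exact: supp_le_derive Mt (dq t).
have DN m f : diffn m f -> diffn m (fun t => - f t).
  move=> /(diffnM (diffn_cst m (-1))); congr diffn.
  by apply/funext => t; rewrite mulN1r.
have N0 f : supp_le M f -> supp_le M (fun t => - f t).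
  by move=> f0 t tM; rewrite f0// oppr0.
have [C1 HC1] := IH _ _ (DN n.+1 q' Dq') Dp' (N0 _ q'0) p'0.
have [C2 HC2] := IH _ _ (DN _ _ Dq1) Dp1 (N0 _ q0) p0.
have tau0 : 0 < 2 * pi :> R by rewrite mulr_gt0// pi_gt0.
exists ((C1 + 2 * pi * H * C2) / (2 * pi)) => x y yH.
have cp' := @diffn_continuous _ n _ Dp'; have cq' := @diffn_continuous _ n _ Dq'.
have E := cfourier_re_parts x y dp dq cp' cq' p0 q0.
rewrite ler_pdivlMr//.
have -> : `|x| ^+ n.+1 * `|cfourier_re p q (x, y)| * (2 * pi) =
          `|x| ^+ n * `|2 * pi * x * cfourier_re p q (x, y)|.
  by rewrite normrM (normrM (2 * pi)) (gtr0_norm tau0) exprSr; ring.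
move/eqP: E; rewrite addr_eq0 => /eqP ->; rewrite normrN.
apply: (@le_trans _ _ (`|x| ^+ n * (`|cfourier_re (fun t => - q' t) p' (x, y)| +
   2 * pi * H * `|cfourier_re (fun t => - q t) p (x, y)|))).
  rewrite ler_wpM2l ?exprn_ge0// (le_trans (ler_normD _ _))// lerD2l.
  by rewrite normrM ler_wpM2r// normrM gtr0_norm// ler_pM2l.
rewrite mulrDr lerD ?HC1//.
have -> : `|x| ^+ n * (2 * pi * H * `|cfourier_re (fun t => - q t) p (x, y)|) =
  2 * pi * H * (`|x| ^+ n * `|cfourier_re (fun t => - q t) p (x, y)|) by ring.
by rewrite ler_wpM2l ?HC2// mulr_ge0// ltW.
Qed.

Lemma cfourier_re_rapid_decay n M H p q : 0 <= H ->
  (forall m, diffn m p) -> (forall m, diffn m q) -> supp_le M p -> supp_le M q ->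
  exists C : R, forall x y, `|y| <= H ->
    (1 + `|x|) ^+ n * `|cfourier_re p q (x, y)| <= C.
Proof.
move=> H0 Dp Dq p0 q0.
have [C1 HC1] := cfourier_re_decay H0 (Dp 1%N) (Dq 1%N) p0 q0.
have [C2 HC2] := cfourier_re_decay H0 (Dp n.+1) (Dq n.+1) p0 q0.
(* [1 + |x|] is at most 2 when [|x| <= 1] and at most [2 |x|] otherwise. *)
exists (2 ^+ n * (C1 + C2)) => x y yH.
have {}HC1 := HC1 x y yH; have {}HC2 := HC2 x y yH.
rewrite expr0 mul1r in HC1.
set r := `|cfourier_re p q (x, y)| in HC1 HC2 *.
have r0 : 0 <= r by rewrite normr_ge0.
have C10 : 0 <= C1 by exact: le_trans HC1.
have C20 : 0 <= C2 by apply: le_trans HC2; rewrite mulr_ge0// exprn_ge0.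
have [x1|x1] := leP `|x| 1.
  rewrite ler_pM ?exprn_ge0 ?addr_ge0//; last by rewrite (le_trans HC1)// lerDl.
  by rewrite lerXn2r ?nnegrE ?addr_ge0//; lra.
apply: (@le_trans _ _ ((2 * `|x|) ^+ n * r)).
  by rewrite ler_wpM2r// lerXn2r ?nnegrE ?addr_ge0 ?mulr_ge0//; lra.
by rewrite exprMn -mulrA ler_wpM2l ?exprn_ge0// (le_trans HC2)// lerDr.
Qed.

(** The integrand is jointly measurable in [(z, t)]; Tonelli is applied to its positive and negative
    parts. *)
Lemma measurable_cfourier_re p q : continuous p -> continuous q ->
  measurable_fun [set: R * R] (cfourier_re p q).
Proof.
move=> /continuous_measurable_fun mp /continuous_measurable_fun mq.
pose f (w : (R * R) * measurableTypeR R) : \bar R :=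
  (cfourier_re_integrand p q w.1.1 w.1.2 w.2)%:E.
have mf : measurable_fun setT f.
  have m3 : measurable_fun [set: (R * R) * measurableTypeR R] (fun w => w.2 : R).
    exact: measurable_snd.
  have m1 : measurable_fun [set: (R * R) * measurableTypeR R] (fun w => w.1.1 : R).
    by apply: measurableT_comp measurable_fst measurable_fst.
  have m2 : measurable_fun [set: (R * R) * measurableTypeR R] (fun w => w.1.2 : R).
    by apply: measurableT_comp measurable_snd measurable_fst.
  have mx : measurable_fun [set: (R * R) * measurableTypeR R]
      (fun w => 2 * pi * w.1.1 * w.2 : R).
    by apply: measurable_funM => //; apply: measurable_funM.
  have my : measurable_fun [set: (R * R) * measurableTypeR R]
      (fun w => 2 * pi * w.1.2 * w.2 : R).
    by apply: measurable_funM => //; apply: measurable_funM.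
  have me := continuous_measurable_fun (@continuous_expR R).
  have mc := continuous_measurable_fun (@continuous_cos R).
  have ms := continuous_measurable_fun (@continuous_sin R).
  apply/measurable_EFinP; apply: measurable_funM.
    exact: measurableT_comp me my.
  apply: measurable_funD; apply: measurable_funM.
  - exact: measurableT_comp mp m3.
  - exact: measurableT_comp mc mx.
  - exact: measurableT_comp mq m3.
  - exact: measurableT_comp ms mx.
have mpos := measurable_fun_fubini_tonelli_F (m2 := mu) _ (measurable_funepos mf).
have mneg := measurable_fun_fubini_tonelli_F (m2 := mu) _ (measurable_funeneg mf).
rewrite (_ : cfourier_re p q = fine \o (fun z => fubini_F mu (f^\+)%E z - fubini_F mu (f^\-)%E z)%E).
  apply: measurableT_comp; first exact: fine_measurable.
  apply: emeasurable_funB.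
    by apply: mpos => z; exact: funepos_ge0.
  by apply: mneg => z; exact: funeneg_ge0.
apply/funext => z; rewrite /cfourier_re /Rintegral/=; congr fine.
rewrite [LHS]integralE /fubini_F.
by congr (_ - _)%E; apply: eq_integral => t _; rewrite ?funeposE ?funenegE.
Qed.

End cfourier_decay.

(** * Regularity, approximate harmonicity and boundary values of the transform *)

Section positive_kernel.
Context {R : realType}.
Implicit Types (p f phi psi : R -> R) (a T H x y t : R).
Local Notation mu := (@lebesgue_measure R).

Definition strip_fourier phi x y : R :=
  Rintegral mu [set: R] (fun t => expR (2 * pi * y * t) * (phi t * cos (2 * pi * x * t))).

Lemma ccont_strip_fourier phi x y : ccont phi ->
  ccont (fun t => expR (2 * pi * y * t) * (phi t * cos (2 * pi * x * t))).
Proof.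
move=> cphi; apply: ccontMl; last exact: continuous_expR_scale.
by apply: ccontMr => //; exact: continuous_cos_scale.
Qed.

Lemma strip_fourier_bounded phi T H x y : ccont phi -> supp_le T phi ->
  (forall t, 0 <= phi t) -> `|y| <= H ->
  `|strip_fourier phi x y| <= expR (2 * pi * H * T) * Rintegral mu [set: R] phi.
Proof.
move=> cphi phi0 phige0 yH; rewrite -Rintegral_ccontZ//.
apply: le_norm_Rintegral_ccont; first exact: ccont_strip_fourier.
  exact: ccontZ.
move=> t; rewrite mulrA normrM -[leRHS]mulr1 ler_pM ?cos_max//.
by rewrite (le_trans (expR_supp_le _ yH phi0))// ger0_norm.
Qed.

(** For [b <= a] this follows from [e^(b - a) >= 1 + (b - a)]. *)
Lemma expR_lipschitz (a b c : R) : a <= c -> b <= c ->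
  `|expR a - expR b| <= expR c * `|a - b|.
Proof.
wlog ab : a b / b <= a.
  move=> h ac bc; have [ba|/ltW ab] := leP b a; first exact: h.
  by rewrite distrC [`|a - b|]distrC; exact: h.
move=> ac bc; rewrite !ger0_norm ?subr_ge0 ?ler_expR//.
have := expR_ge1Dx (b - a); rewrite expRD expRN => h.
have ea := expR_gt0 a.
have : expR a - expR b <= expR a * (a - b).
  have : expR a * (1 + (b - a)) <= expR a * (expR b / expR a) by rewrite ler_pM2l.
  rewrite [X in _ <= X]mulrC divfK ?gt_eqF//; lra.
move=> /le_trans; apply; rewrite ler_wpM2r ?subr_ge0// ler_expR//.
Qed.

Lemma strip_fourier_lipschitz phi T H x y y' : ccont phi -> supp_le T phi ->
  (forall t, 0 <= phi t) -> 0 <= T -> `|y| <= H -> `|y'| <= H ->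
  `|strip_fourier phi x y - strip_fourier phi x y'| <=
  expR (2 * pi * H * T) * (2 * pi * T) * Rintegral mu [set: R] phi * `|y - y'|.
Proof.
move=> cphi phi0 phige0 T0 yH y'H.
have c1 := ccont_strip_fourier x y cphi; have c2 := ccont_strip_fourier x y' cphi.
rewrite [X in _ <= X]mulrAC -Rintegral_ccontZ// /strip_fourier -mulN1r.
rewrite -(Rintegral_ccontZ _ c2) -Rintegral_ccontD//; last exact: ccontZ.
apply: le_norm_Rintegral_ccont; [apply: ccontD => //; exact: ccontZ|exact: ccontZ|].
move=> t; rewrite mulN1r -mulrBl normrM.
have [tT|tT] := leP `|t| T; last by rewrite phi0// mul0r normr0 !mulr0.
rewrite ler_pM//; last by rewrite normrM ger0_norm// ler_piMr// cos_max.
rewrite (le_trans (@expR_lipschitz _ _ (2 * pi * H * T) _ _))//.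
- rewrite -!mulrA ler_pM2l// ler_pM2l ?pi_gt0//.
  by rewrite (le_trans (ler_norm _))// normrM ler_pM.
- rewrite -!mulrA ler_pM2l// ler_pM2l ?pi_gt0//.
  by rewrite (le_trans (ler_norm _))// normrM ler_pM.
rewrite -mulrBl -mulrBr !normrM -!mulrA ler_pM2l ?expR_gt0//.
rewrite (gtr0_norm (ltr0Sn R 1)) (gtr0_norm (pi_gt0 R)) ler_pM2l// ler_pM2l ?pi_gt0//.
by rewrite mulrC ler_wpM2r.
Qed.

(** Harmonicity in discrete form: the five-point difference multiplies
    [exp (2 pi y t) cos (2 pi x t)] by [2 (cos w + cosh w - 2)] with [w = 2 pi h t], which is o(h^2)
    uniformly on the support. *)
Lemma strip_fourier_mean phi T H : ccont phi -> supp_le T phi ->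
  (forall t, 0 <= phi t) -> 0 < T ->
  forall e : R, 0 < e -> exists2 h0 : R, 0 < h0 & forall h : R, 0 < h <= h0 ->
    forall x y, `|y| + h <= H ->
    `|strip_fourier phi (x + h) y + strip_fourier phi (x - h) y +
      strip_fourier phi x (y + h) + strip_fourier phi x (y - h) -
      4 * strip_fourier phi x y| <= e * h ^+ 2.
Proof.
move=> cphi phi0 phige0 T0 e e0.
pose I := Rintegral mu [set: R] phi.
have I0 : 0 <= I by apply: Rintegral_ge0.
pose tau : R := 2 * pi.
have tau0 : 0 < tau by rewrite mulr_gt0// pi_gt0.
(* [K] collects the constants of the final estimate; the added 1 allows division by [K] even when
   the integral of [phi] is zero. *)
pose K := expR (tau * H * T) * (2 * (tau * T) ^+ 2) * I + 1.
have K0 : 0 < K.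
  by rewrite ltr_wpDl// mulr_ge0// mulr_ge0 ?expR_ge0// mulr_ge0// sqr_ge0.
have [d d0 hd] := cos_cosh_mean (divr_gt0 e0 K0).
(* This keeps [|tau h t| <= d] for all [t] in the support. *)
exists (d / (tau * T)); first by rewrite divr_gt0// mulr_gt0.
move=> h /andP[h0 hh] x y yh.
have yH : `|y| <= H by rewrite (le_trans _ yh)// lerDl ltW.
pose G t := expR (tau * y * t) * (phi t * cos (tau * x * t)) *
  (2 * (cos (tau * h * t) + (expR (tau * h * t) + expR (- (tau * h * t))) / 2 - 2)).
have E : strip_fourier phi (x + h) y + strip_fourier phi (x - h) y +
      strip_fourier phi x (y + h) + strip_fourier phi x (y - h) -
      4 * strip_fourier phi x y = Rintegral mu [set: R] G.
  have c a b := ccont_strip_fourier a b cphi.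
  rewrite /strip_fourier -mulNr -(Rintegral_ccontZ _ (c _ _)).
  rewrite -!Rintegral_ccontD//; try by [exact: ccontZ|apply: ccontD => //;
     apply: ccontD => //; exact: ccontD|apply: ccontD => //; exact: ccontD|exact: ccontD].
  apply: eq_Rintegral => t _; rewrite /G -/tau.
  have dP b : tau * (b + h) * t = tau * b * t + tau * h * t by ring.
  have dM b : tau * (b - h) * t = tau * b * t - tau * h * t by ring.
  by rewrite !dP !dM !expRD cosD cosB; field.
rewrite E.
have cG : ccont G.
  apply: ccontMr; first exact: ccont_strip_fourier.
  have D : diffn 1 (fun t => 2 * (cos (tau * h * t) +
     (expR (tau * h * t) + expR (- (tau * h * t))) / 2 - 2)).
    apply: diffnM; first exact: diffn_cst.
    apply: diffnD; last exact: diffn_cst.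
    apply: diffnD; first by apply: diffn_scale; case: (@diffn_cos_sin R 1).
    apply: diffnM; last exact: diffn_cst.
    apply: diffnD; first by apply: diffn_scale; exact: diffn_expR.
    have := diffn_scale (- (tau * h)) (@diffn_expR R 1).
    by congr diffn; apply/funext => t; rewrite mulNr.
  exact: diffn_continuous D.
apply: (@le_trans _ _ (Rintegral mu [set: R]
   (fun t => expR (tau * H * T) * (2 * (e / K * (tau * h * T) ^+ 2)) * phi t))).
  apply: le_norm_Rintegral_ccont => //; first exact: ccontZ.
  move=> t; rewrite /G normrM mulrA normrM.
  have [tT|tT] := leP `|t| T; last by rewrite phi0// !mulr0 normr0 !mul0r.
  have tht : `|tau * h * t| <= tau * h * T.
    have th : 0 < tau * h by rewrite mulr_gt0.
    by rewrite normrM (gtr0_norm th) (ler_pM2l th).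
  have thT : tau * h * T <= d.
    have tT0 : 0 < tau * T by rewrite mulr_gt0.
    move: hh; rewrite (ler_pdivlMr _ _ tT0) => /(le_trans _); apply.
    by rewrite (_ : tau * h * T = h * (tau * T)); last by ring.
  have A := hd _ (le_trans tht thT).
  have B : e / K * (tau * h * t) ^+ 2 <= e / K * (tau * h * T) ^+ 2.
    rewrite ler_wpM2l ?(divr_ge0 (ltW e0) (ltW K0))// -[(tau * h * t) ^+ 2]real_normK ?num_real//.
    by rewrite lerXn2r// nnegrE (le_trans _ tht).
  rewrite [leRHS](_ : _ = (expR (tau * H * T) * phi t) * 1 *
      (2 * (e / K * (tau * h * T) ^+ 2))); last by ring.
  rewrite ler_pM ?mulr_ge0//.
    rewrite ler_pM ?cos_max//; have := expR_supp_le t yH phi0.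
    by rewrite [`|phi t|]ger0_norm.
  by rewrite normrM (gtr0_norm (ltr0Sn R 1)) ler_pM2l// (le_trans A).
rewrite Rintegral_ccontZ// -/I.
have -> : expR (tau * H * T) * (2 * (e / K * (tau * h * T) ^+ 2)) * I =
  (expR (tau * H * T) * (2 * (tau * T) ^+ 2) * I) / K * (e * h ^+ 2) by field; rewrite gt_eqF.
rewrite ler_piMl ?(mulr_ge0 (ltW e0) (sqr_ge0 _))//.
by rewrite ler_pdivrMr// mul1r /K lerDl.
Qed.

Definition cosh2 a : R := (expR a + expR (- a)) / 2.

Lemma cosh2_gt0 a : 0 < cosh2 a.
Proof. by rewrite divr_gt0// addr_gt0 ?expR_gt0. Qed.

Lemma diffn_cosh2_inv n a : diffn n (fun t => (cosh2 (a * t))^-1).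
Proof.
apply: diffn_inv; first by move=> t; rewrite gt_eqF ?cosh2_gt0.
apply: diffnM; last exact: diffn_cst.
apply: diffnD; first by apply: diffn_scale; exact: diffn_expR.
have := diffn_scale (- a) (@diffn_expR R n).
by congr diffn; apply/funext => t; rewrite mulNr.
Qed.

(* Dividing by cosh makes the boundary values at y = +-H of the transform equal
   to the cosine transform of psi, because tanh is odd. *)
Lemma strip_fourier_boundary psi H x y : ccont psi ->
  (forall t, psi (- t) = psi t) -> `|y| = H ->
  strip_fourier (fun t => psi t * (cosh2 (2 * pi * H * t))^-1) x y =
  Rintegral mu [set: R] (fun t => psi t * cos (2 * pi * x * t)).
Proof.
move=> cpsi psiE yH.
have ct : ccont (fun t => psi t * (cosh2 (2 * pi * H * t))^-1).
  apply: ccontMr => //.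
  exact: diffn_continuous (diffn_cosh2_inv 1 (2 * pi * H)).
have c := ccont_strip_fourier x y ct.
set f := (fun t => expR (2 * pi * y * t) * _) in c.
(* Adding the reflection [t -> -t] retains only the even part of the exponential, and the resulting
   hyperbolic cosine cancels the denominator. *)
suff : strip_fourier (fun t => psi t * (cosh2 (2 * pi * H * t))^-1) x y +
   Rintegral mu [set: R] (fun t => f (- t)) =
   2 * Rintegral mu [set: R] (fun t => psi t * cos (2 * pi * x * t)).
  have [cf [M f0]] := c; rewrite (Rintegral_opp cf f0) /strip_fourier -/f; lra.
have cN : ccont (fun t => f (- t)).
  have [cf [M f0]] := c; split; last by exists M => t tM; rewrite f0// normrN.
  move=> t; apply: (@continuous_comp _ _ _ -%R f); last exact: cf.
  exact: opp_continuous.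
rewrite -[strip_fourier _ _ _]/(Rintegral mu [set: R] f) -Rintegral_ccontD//.
rewrite -Rintegral_ccontZ; last by apply: ccontMr => //; exact: continuous_cos_scale.
apply: eq_Rintegral => t _; rewrite /f psiE !mulrN cosN.
have chE : cosh2 (- (2 * pi * H * t)) = cosh2 (2 * pi * H * t).
  by rewrite /cosh2 opprK addrC.
rewrite chE.
have E2 : 2 = (expR (2 * pi * y * t) + expR (- (2 * pi * y * t))) / cosh2 (2 * pi * H * t).
  have -> : cosh2 (2 * pi * H * t) = cosh2 (2 * pi * y * t).
    have [y0|y0] := leP 0 y; first by rewrite -yH ger0_norm.
    by rewrite -yH ltr0_norm// mulrN mulNr -[RHS]/(cosh2 _) /cosh2 opprK addrC.
  have := cosh2_gt0 (2 * pi * y * t); rewrite /cosh2 => h.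
  by rewrite invf_div mulrCA divff ?mulr1// gt_eqF// -(pmulr_lgt0 _ (_ : 0 < 2^-1 :> R)).
by rewrite [X in _ = X * _]E2; ring.
Qed.

End positive_kernel.

(** * Integrability on the strip from polynomial growth of the measure *)

Section growth_integrable.
Context {R : realType}.
Variables (H C0 rho : R) (mu : {measure set (R * R) -> \bar R}).

Lemma measurable_strip : measurable (strip H : set (R * R)).
Proof.
rewrite (_ : strip H = setT `&` snd @^-1` `[(- H)%R, H]%classic).
  by apply: (@measurable_snd _ _ R R) => //; exact: measurable_itv.
by apply/seteqP; split => [z|z [_]]; rewrite /strip/= in_itv/= ler_norml.
Qed.

Lemma measurable_strip_box (a b : R) :
  measurable [set z : R * R | z \in strip H /\ (a <= z.1 <= b)%R].
Proof.
rewrite (_ : [set z | _] = strip H `&` (setT `&` fst @^-1` `[a, b]%classic)).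
  apply: measurableI; first exact: measurable_strip.
  by apply: (@measurable_fst _ _ R R) => //; exact: measurable_itv.
apply/seteqP; split => [z [/set_mem sz ab]|z [sz [_ ab]]]; split => //=.
exact: mem_set.
Qed.

(** Induction goes through for the sharper bound [2 - 1/n], which telescopes. *)
Lemma sum_invr_sqr_le (n : nat) :
  \sum_(0 <= k < n) (k.+1%:R ^+ 2)^-1 <= 2 :> R.
Proof.
case: n => [|n]; first by rewrite big_nil.
suff : \sum_(0 <= k < n.+1) (k.+1%:R ^+ 2)^-1 <= 2 - n.+1%:R^-1 :> R.
  by move=> /le_trans; apply; rewrite gerBl invr_ge0.
elim: n => [|n IH]; first by rewrite big_nat1 expr1n invr1; lra.
rewrite big_nat_recr//= (le_trans (lerD IH (lexx _)))//.
have n1 : 0 < n.+1%:R :> R by rewrite ltr0n.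
have -> : n.+2%:R = n.+1%:R + 1 :> R by rewrite -natr1.
move: n1; move: (n.+1%:R : R) => a a0.
have a1 : 0 < a + 1 by rewrite addr_gt0.
have E : (2 - (a + 1)^-1) - (2 - a^-1 + ((a + 1) ^+ 2)^-1) = (a * (a + 1) ^+ 2)^-1.
  by field; rewrite !gt_eqF.
by rewrite -subr_ge0 E invr_ge0 mulr_ge0 ?sqr_ge0// ltW.
Qed.

Hypothesis C0_gt0 : 0 < C0.
Hypothesis rho_gt0 : 0 < rho.
Hypothesis growth : forall r : R, 0 < r ->
  (mu [set z | z \in strip H /\ (`|z.1| <= r)%R] <=
    (C0 * Num.max 1 (r `^ rho))%:E)%E.

(** If [k] is the integer part of [|Re z|], then [z] lies in [A k] and [|f z| <= C / (k+1)^(r+2)].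
    Hence [|f|] is dominated by a series of multiples of indicators, and since [A k] has mass at
    most [C0 (k+1)^r], the integrals sum like [1 / (k+1)^2]. *)
Lemma strip_integrable (f : R * R -> R) : measurable_fun [set: R * R] f ->
  (forall n, exists C, forall z, strip H z -> (1 + `|z.1|) ^+ n * `|f z| <= C) ->
  mu.-integrable (strip H) (EFin \o f).
Proof.
(* An integer [r >= rho] replaces real powers by ordinary ones; two more powers of decay make the
   series converge. *)
move=> mf decay; pose r := Num.bound rho.
have rhor : rho <= r%:R by rewrite ltW// archi_boundP// ltW.
have [C1 HC1] := decay (r + 2)%N.
pose C : R := `|C1|.
have HC z : strip H z -> (1 + `|z.1|) ^+ (r + 2) * `|f z| <= C.
  by move=> /HC1 /le_trans; apply; exact: ler_norm.
have C_ge0 : 0 <= C by exact: normr_ge0.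
pose A k := [set z : R * R | z \in strip H /\ (`|z.1| <= k.+1%:R)%R].
have mA k : measurable (A k).
  rewrite (_ : A k = [set z : R * R | z \in strip H /\ (- k.+1%:R <= z.1 <= k.+1%:R)%R]).
    exact: measurable_strip_box.
  by apply/seteqP; split => z; rewrite /A/= ler_norml.
have muA k : (mu (A k) <= (C0 * k.+1%:R ^+ r)%:E)%E.
  rewrite (le_trans (growth _))// ?ltr0n// lee_fin ler_pM2l// ge_max.
  have k1 : 1 <= k.+1%:R :> R by rewrite ler1n.
  rewrite exprn_ege1//= -powR_mulrn//; exact: ler_powR.
pose c k : R := C / k.+1%:R ^+ (r + 2).
have c0 k : 0 <= c k by rewrite divr_ge0// exprn_ge0.
pose g k (z : R * R) : \bar R := (c k * \1_(A k) z)%:E.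
have g0 k z : (0 <= g k z)%E by rewrite lee_fin mulr_ge0.
have mg k : measurable_fun (strip H) (g k).
  apply/measurable_EFinP; apply: measurable_funM => //.
have ms := measurable_strip.
apply/integrableP; split.
  by apply/measurable_EFinP; apply: measurable_funS mf.
apply: (@le_lt_trans _ _ (\int[mu]_(z in strip H) (\sum_(k <oo) g k z))%E).
  apply: ge0_le_integral => //.
  - apply: measurableT_comp => //; apply/measurable_EFinP; exact: measurable_funS mf.
  - by apply: ge0_emeasurable_sum.
  move=> z sz /=.
  have /andP[k1 k2] := truncn_itv (normr_ge0 z.1).
  set k := Num.truncn `|z.1| in k1 k2.
  apply: (@le_trans _ _ (g k z)).
    rewrite lee_fin indicE mem_set; last by split; [exact: mem_set|exact: ltW].
    rewrite mulr1 ler_pdivlMr ?exprn_gt0 ?ltr0n// mulrC (le_trans _ (HC _ sz))//.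
    rewrite ler_wpM2r// lerXn2r ?nnegrE ?addr_ge0//.
    by rewrite -natr1 addrC lerD2l.
  apply: (le_trans _ (nneseries_lim_ge k.+1 _)) => //.
  by rewrite big_nat_recr//= leeDr// sume_ge0.
rewrite integral_nneseries//.
apply: (@le_lt_trans _ _ ((C * C0) * 2)%:E); last exact: ltry.
apply: lime_le.
  by apply: is_cvg_nneseries => k _ _; apply: integral_ge0.
apply: nearW => n.
apply: (@le_trans _ _ (\sum_(0 <= k < n) ((C * C0) * (k.+1%:R ^+ 2)^-1)%:E)%E).
  apply: lee_sum => k _; rewrite /g.
  under eq_integral do rewrite EFinM.
  rewrite ge0_integralZl//; last 2 first.
  - by apply/measurable_EFinP.
  - by rewrite lee_fin.
  rewrite integral_indic//.
  apply: (@le_trans _ _ ((c k)%:E * mu (A k))%E).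
    by rewrite lee_wpmul2l ?lee_fin// le_measure// inE//; exact: measurableI.
  apply: (@le_trans _ _ ((c k)%:E * (C0 * k.+1%:R ^+ r)%:E)%E).
    by rewrite lee_wpmul2l ?lee_fin.
  rewrite -EFinM lee_fin /c exprD.
  have k1 : 0 < k.+1%:R :> R by rewrite ltr0n.
  rewrite le_eqVlt; apply/orP; left; apply/eqP; field.
  by rewrite addrC natr1 !gt_eqF ?exprn_gt0.
rewrite sumEFin lee_fin -mulr_sumr ler_wpM2l ?sum_invr_sqr_le//.
by rewrite mulr_ge0// ltW.
Qed.

End growth_integrable.

(** * The kernel, its positivity and lower bound, and its modulations *)

Section kernel.
Context {R : realType}.
Implicit Types (a H x y t s : R) (n : nat).
Local Notation leb := (@lebesgue_measure R).
Local Notation seg M := (`[(- M)%R, M%R]%classic).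

Definition strip_kernel a H t : R :=
  corr (smooth_bump a) (smooth_bump a) t * (cosh2 (2 * pi * H * t))^-1.

Lemma continuous_bump a : continuous (smooth_bump a).
Proof. exact: diffn_continuous (diffn_bump 1 a). Qed.

Lemma diffn_corr_bump n a : diffn n (corr (smooth_bump a) (smooth_bump a)).
Proof.
exact: diffn_corr (@continuous_bump a) (@bump_supp _ a) (diffn_bump _ a) (@bump_supp _ a).
Qed.

Lemma corr_bump_supp a : supp_le (a + a) (corr (smooth_bump a) (smooth_bump a)).
Proof. by apply: corr_supp; exact: bump_supp. Qed.

Lemma diffn_kernel n a H : diffn n (strip_kernel a H).
Proof.
by apply: diffnM; [exact: diffn_corr_bump|exact: diffn_cosh2_inv].
Qed.

Lemma kernel_supp a H : supp_le (a + a) (strip_kernel a H).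
Proof. by apply: supp_leMr; exact: corr_bump_supp. Qed.

Lemma kernel_ge0 a H t : 0 <= strip_kernel a H t.
Proof.
rewrite mulr_ge0 ?invr_ge0 ?(ltW (cosh2_gt0 _))//.
by apply: corr_ge0; exact: bump_ge0.
Qed.

Lemma ccont_kernel a H : ccont (strip_kernel a H).
Proof.
split; first exact: diffn_continuous (diffn_kernel 1 a H).
by exists (a + a); exact: kernel_supp.
Qed.

Lemma strip_fourier_kernel_ge0 a H x y : 0 < a -> 0 < H -> `|y| <= H ->
  0 <= strip_fourier (strip_kernel a H) x y.
Proof.
move=> a0 H0; have ck := ccont_kernel a H; have k0 := @kernel_supp a H.
have kge0 := @kernel_ge0 a H.
have boundary z w : `|w| = H -> 0 <= strip_fourier (strip_kernel a H) z w.
  have cpsi : ccont (corr (smooth_bump a) (smooth_bump a)).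
    split; first exact: diffn_continuous (diffn_corr_bump 1 a).
    by exists (a + a); exact: corr_bump_supp.
  have psiE t : corr (smooth_bump a) (smooth_bump a) (- t) =
      corr (smooth_bump a) (smooth_bump a) t.
    exact: corr_even (@continuous_bump a) (@bump_supp _ a).
  move=> wH.
  have -> : strip_fourier (strip_kernel a H) z w = _ :=
    strip_fourier_boundary z cpsi psiE wH.
  rewrite (Rintegral_corr_cos _ (@continuous_bump a) (@bump_supp _ a)).
  by rewrite addr_ge0// sqr_ge0.
move: x y; apply: (@strip_minimum_principle _ _ H _ _ H0).
- by move=> x y yH; exact: strip_fourier_bounded ck k0 kge0 yH.
- by move=> x y y' yH y'H; apply: (strip_fourier_lipschitz x ck k0 kge0 _ yH y'H); rewrite addr_ge0// ltW.
- by move=> x; apply: boundary; rewrite gtr0_norm.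
- by move=> x; apply: boundary; rewrite normrN gtr0_norm.
- by apply: strip_fourier_mean ck k0 kge0 _; rewrite addr_gt0.
Qed.

(** Comparison with a constant on [[-a/2, a/2]], an interval of length [a]. *)
Lemma Rintegral_bump_gt0 a : 0 < a -> 0 < Rintegral leb [set: R] (smooth_bump a).
Proof.
move=> a0; pose c := expR (- (4 / a)).
have c0 : 0 < c by exact: expR_gt0.
have ib : leb.-integrable [set: R] (EFin \o smooth_bump a).
  exact: supp_le_lebesgue_integrable (@continuous_bump a) (@bump_supp _ a).
have ic : leb.-integrable [set: R] (EFin \o ((cst c : R -> R) \_ (seg (a / 2)))).
  rewrite -restrict_EFin; apply/(@integrable_mkcond _ _ _ leb (seg (a / 2))) => //.
  apply: continuous_compact_integrable; first exact: segment_compact.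
  by apply: continuous_subspaceT => t; exact: cvg_cst.
apply: (@lt_le_trans _ _ (c * a)); first by rewrite mulr_gt0.
have -> : c * a = Rintegral leb [set: R] ((cst c : R -> R) \_ (seg (a / 2))).
  rewrite -(@Rintegral_mkcond _ _ _ leb) Rintegral_cst//; congr (c * _).
  have E : leb (seg (a / 2)) = a%:E.
    rewrite [LHS]lebesgue_measure_itv/= lte_fin ifT; last by lra.
    by rewrite -EFinD; congr EFin; lra.
  by rewrite [X in fine X]E.
apply: (le_Rintegral _ ic ib) => // t _; rewrite /patch; case: ifPn => [|_]; last exact: bump_ge0.
by rewrite inE/= in_itv/= -ler_norml => ta; exact: bump_ge.
Qed.

(** The small support puts [2 pi x t] in [[-1, 1]], where the cosine is at least [cos 1 > 0]; the
    exponential and the inverse hyperbolic cosine are each at least [E]. *)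
Lemma strip_fourier_kernel_ge a H : 0 < a -> 2 * pi * (a + a) <= 1 -> 0 < H ->
  exists2 c : R, 0 < c & forall x y, `|x| <= 1 -> `|y| <= H ->
    c <= strip_fourier (strip_kernel a H) x y.
Proof.
move=> a0 api H0; pose psi := corr (smooth_bump a) (smooth_bump a).
pose T := a + a; have T0 : 0 < T by rewrite addr_gt0.
pose E := expR (- (2 * pi * H * T)); have E0 : 0 < E by exact: expR_gt0.
have cos10 : 0 < cos 1 :> R by exact: cos1_gt0.
have cpsi : ccont psi.
  split; first exact: diffn_continuous (diffn_corr_bump 1 a).
  by exists (a + a); exact: corr_bump_supp.
have psi0 t : 0 <= psi t by apply: corr_ge0; exact: bump_ge0.
(* At frequency 0 the cosine transform of [psi] is its integral, which is thus the square of the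
   integral of the bump. *)
have Ipsi : 0 < Rintegral leb [set: R] psi.
  have := Rintegral_corr_cos 0 (@continuous_bump a) (@bump_supp _ a).
  have c1 (f : R -> R) : (fun t => f t * cos (0 * t)) = f.
    by apply/funext => t; rewrite mul0r cos0 mulr1.
  rewrite !c1 => ->; rewrite ltr_wpDr ?sqr_ge0// exprn_gt0//.
  exact: Rintegral_bump_gt0.
exists (E * E * cos 1 * Rintegral leb [set: R] psi).
  by rewrite mulr_gt0// mulr_gt0// mulr_gt0.
move=> x y x1 yH; rewrite -Rintegral_ccontZ//.
apply: le_Rintegral_ccont; first exact: ccontZ.
  exact: ccont_strip_fourier (ccont_kernel a H).
move=> t; have [tT|tT] := leP `|t| T; last first.
  by rewrite (kernel_supp _ tT) /psi (corr_bump_supp tT) mul0r !mulr0.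
have tau0 : 0 < 2 * pi :> R by rewrite mulr_gt0// pi_gt0.
have eE w : `|w| <= H -> E <= expR (2 * pi * w * t).
  move=> wH; rewrite ler_expR -!mulrA -!mulrN ler_pM2l// ler_pM2l ?pi_gt0//.
  have : `|w * t| <= H * T by rewrite normrM ler_pM.
  by rewrite ler_norml mulrN => /andP[].
have chE : E <= (cosh2 (2 * pi * H * t))^-1.
  rewrite /E expRN lef_pV2 ?posrE ?expR_gt0 ?cosh2_gt0//.
  have u : `|2 * pi * H * t| <= 2 * pi * H * T.
    by rewrite normrM gtr0_norm ?ler_pM2l// mulr_gt0.
  move: u; rewrite ler_norml => /andP[u1 u2].
  have : expR (2 * pi * H * t) <= expR (2 * pi * H * T) by rewrite ler_expR.
  have : expR (- (2 * pi * H * t)) <= expR (2 * pi * H * T) by rewrite ler_expR lerNl.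
  rewrite /cosh2; lra.
have cosE : cos 1 <= cos (2 * pi * x * t).
  rewrite -[leRHS]cos_norm.
  have : `|2 * pi * x * t| <= 1.
    rewrite -mulrA normrM (gtr0_norm tau0) (le_trans _ api)// ler_pM2l//.
    by rewrite normrM -[leRHS]mul1r ler_pM.
  move=> h1; have pi2 := @pi_ge2 R.
  have in1 : (1 : R) \in `[0, pi] by rewrite in_itv/=; lra.
  have inx : `|2 * pi * x * t| \in `[0, pi] by rewrite in_itv/= normr_ge0/=; lra.
  by rewrite leNgt (ltr_cos in1 inx) -leNgt.
rewrite /strip_kernel -/psi.
rewrite [leLHS](_ : _ = E * (psi t * E * cos 1)); last by ring.
apply: ler_pM => //; [exact: ltW|by rewrite !mulr_ge0// ltW|exact: eE|].
by apply: ler_pM => //; [rewrite mulr_ge0// ltW|exact: ltW|rewrite ler_wpM2l].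
Qed.

Definition kernel_cos a H s t : R := strip_kernel a H t * cos (2 * pi * s * t).
Definition kernel_sin a H s t : R := strip_kernel a H t * sin (2 * pi * s * t).

Lemma diffn_kernel_cos n a H s : diffn n (kernel_cos a H s).
Proof.
apply: diffnM; first exact: diffn_kernel.
by apply: diffn_scale; case: (@diffn_cos_sin R n).
Qed.

Lemma diffn_kernel_sin n a H s : diffn n (kernel_sin a H s).
Proof.
apply: diffnM; first exact: diffn_kernel.
by apply: diffn_scale; case: (@diffn_cos_sin R n).
Qed.

(** The pair consists of the real and imaginary parts of [exp (2 pi i s t)] times the kernel, and
    modulation becomes translation by [s]. *)
Lemma cfourier_re_kernel a H s z :
  cfourier_re (kernel_cos a H s) (kernel_sin a H s) z =
  strip_fourier (strip_kernel a H) (z.1 - s) z.2.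
Proof.
apply: eq_Rintegral => t _; congr (_ * _).
have -> : 2 * pi * (z.1 - s) * t = 2 * pi * z.1 * t - 2 * pi * s * t by ring.
by rewrite cosB /kernel_cos /kernel_sin; ring.
Qed.

Lemma diffn_test_fun M (f : R -> R) : (forall n, diffn n f) -> supp_le M f ->
  test_fun f.
Proof.
move=> Df f0; split; last by exists M.
by move=> n x; exact: diffn_derivable (Df n.+1) x.
Qed.

End kernel.

Theorem theorem1 (R : realType) (H : R) (mu : {measure set (R * R) -> \bar R})
    (C0 rho : R) :
  0 < H -> 0 < C0 -> 0 < rho ->
  mu (~` strip H) = 0%E ->
  (forall r : R, 0 < r ->
     (mu [set z | z \in strip H /\ (`|z.1| <= r)%R] <=
        (C0 * Num.max 1 (r `^ rho))%:E)%E) ->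
  cfourier_is_measure mu H ->
  exists M : R, forall s : R,
    (mu [set z | z \in strip H /\ (s <= z.1 <= s + 1)%R] <= M%:E)%E.
Proof.
move=> H0 C0_gt0 rho_gt0 _ growth [s1 [s2 [s3 [s4 [sfin smu]]]]].
(* With this choice [2 pi (a + a) = pi/4], below 1 because [pi/2 < 2]. *)
pose a : R := 16^-1; have a0 : 0 < a by rewrite invr_gt0.
have api : 2 * pi * (a + a) <= 1 by have := @pihalf_lt2 R; rewrite /a; lra.
have [c c0 hc] := strip_fourier_kernel_ge a0 api H0.
have ck := ccont_kernel a H.
have [B B0 kB] := supp_le_bounded ck.1 (@kernel_supp _ a H).
pose T := a + a.
have fin m : [\/ m = s1, m = s2, m = s3 | m = s4] -> (m `[(- T)%R, T]%classic < +oo)%E.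
  by have [f1 [f2 [f3 f4]]] := sfin (- T) T; case=> ->.
pose V m := fine (m `[(- T)%R, T]%classic : \bar R).
(* Modulation changes neither the support nor the bound [B], so [K] is fixed before [s]. *)
pose K : R := B * (V s1 + V s2 + V s3 + V s4).
exists (K / c) => s.
pose p1 := kernel_cos a H s; pose p2 := kernel_sin a H s.
have p10 : supp_le T p1 by apply: supp_leMr; exact: kernel_supp.
have p20 : supp_le T p2 by apply: supp_leMr; exact: kernel_supp.
have D1 n : diffn n p1 by exact: diffn_kernel_cos.
have D2 n : diffn n p2 by exact: diffn_kernel_sin.
have cp1 := diffn_continuous (D1 1%N); have cp2 := diffn_continuous (D2 1%N).
have p1B t : `|p1 t| <= B.
  by rewrite /p1 /kernel_cos normrM -[B]mulr1 ler_pM ?cos_max.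
have p2B t : `|p2 t| <= B.
  by rewrite /p2 /kernel_sin normrM -[B]mulr1 ler_pM ?sin_max.
have [eq_re _] := smu _ _ (diffn_test_fun D1 p10) (diffn_test_fun D2 p20).
have b1 m : [\/ m = s1, m = s2, m = s3 | m = s4] -> `|Rintegral m [set: R] p1| <= B * V m.
  by move=> mi; apply: le_norm_Rintegral_supp_le => //; exact: fin.
have b2 m : [\/ m = s1, m = s2, m = s3 | m = s4] -> `|Rintegral m [set: R] p2| <= B * V m.
  by move=> mi; apply: le_norm_Rintegral_supp_le => //; exact: fin.
have le_K : Rintegral mu (strip H) (cfourier_re p1 p2) <= K.
  rewrite eq_re /K.
  have := b1 s1 (Or41 _ _ _ erefl); have := b1 s2 (Or42 _ _ _ erefl).
  have := b2 s3 (Or43 _ _ _ erefl); have := b2 s4 (Or44 _ _ _ erefl).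
  rewrite !ler_norml => /andP[? ?] /andP[? ?] /andP[? ?] /andP[? ?]; lra.
have mre := measurable_cfourier_re cp1 cp2.
have ire : mu.-integrable (strip H) (EFin \o cfourier_re p1 p2).
  apply: (strip_integrable C0_gt0 rho_gt0 growth mre) => n.
  have [C HC] := cfourier_re_rapid_decay n (ltW H0) D1 D2 p10 p20.
  by exists C => -[x y] sz; exact: HC.
have ms := measurable_strip H.
set A := [set z | _].
have mA : measurable A by exact: measurable_strip_box.
have AS : A `<=` strip H by move=> z [/set_mem].
have posre z : strip H z -> 0 <= cfourier_re p1 p2 z.
  by move=> sz; rewrite cfourier_re_kernel; exact: strip_fourier_kernel_ge0.
(* Nonnegativity on the whole strip allows the integral to be cut down to the box, where
   [|Re z - s| <= 1] and the lower bound [c] holds. *)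
have main : (c%:E * mu A <= \int[mu]_(z in strip H) (cfourier_re p1 p2 z)%:E)%E.
  apply: (@le_trans _ _ (\int[mu]_(z in A) (cfourier_re p1 p2 z)%:E)%E); last first.
    apply: ge0_subset_integral => //.
    by apply/measurable_EFinP; exact: measurable_funS mre.
  rewrite -integral_cst//; apply: ge0_le_integral => //.
  - by move=> z _; rewrite lee_fin ltW.
  - by apply/measurable_EFinP; exact: measurable_funS mre.
  move=> z [/set_mem sz /andP[sx xs]]; rewrite lee_fin cfourier_re_kernel hc//.
  by rewrite ler_norml; lra.
have : (c%:E * mu A <= K%:E)%E.
  (* [Rintegral] would turn an infinite integral into 0; integrability makes the extended integral
     finite, so that [le_K] really bounds it. *)
  apply: (le_trans main); rewrite -(fineK (integrable_fin_num ms ire)) lee_fin.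
  exact: le_K.
by rewrite -(lee_pdivlMl _ _ c0) -EFinM [c^-1 * K]mulrC.
Qed.
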